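(* Let $\alpha>0$, let $n\ge 2$ be an integer, and let $\alpha_n=n\,\omega_{n-1}^{1/(n-1)}$. Then for every $\gamma>\alpha_n$, $$\sup_{u\in W^{1,n}_{0,\mathrm{rad}}(B):\ \int_B|\nabla u|^n\,dx\le 1}\ \int_B \exp\big((\gamma+|x|^\alpha)\,|u|^{\frac{n}{n-1}}\big)\,dx=+\infty$$ and $$\sup_{u\in W^{1,n}_{0,\mathrm{rad}}(B):\ \int_B|\nabla u|^n\,dx\le 1}\ \int_B \exp\big(\gamma\,|u|^{\frac{n}{n-1}+|x|^\alpha}\big)\,dx=+\infty.$$
   Context: $B$ is the unit ball of $\mathbb R^n$ centered at the origin. $\omega_{n-1}$ is the surface measure of the unit sphere $\mathbb S^{n-1}\subset\mathbb R^n$. $W^{1,n}_{0,\mathrm{rad}}(B)$ is the subspace of $W^{1,n}_0(B)$ consisting of functions radially symmetric about the origin. *)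

(* Defs.v *)
From HB Require Import structures.
From mathcomp Require Import all_boot all_order all_algebra.
From mathcomp Require Import all_classical all_reals all_analysis.

Set Implicit Arguments.
Unset Strict Implicit.
Unset Printing Implicit Defensive.

Import Order.TTheory GRing.Theory Num.Theory.
Import numFieldNormedType.Exports.

Local Open Scope classical_set_scope.
Local Open Scope ring_scope.

(** The library has no measurable structure on ['rV[R]_n] and no [n]-dimensional
    Lebesgue measure.  We put on ['rV[R]_n] the sigma-algebra generated by the
    coordinates, i.e. the Borel sigma-algebra of [R^n]. *)
Definition rV_display : measure_display.
Proof. exact: default_measure_display. Qed.

Section measurable_rV.
Context {R : realType} (n : nat).

Definition rV_coord (i : 'I_n) (x : 'rV[R]_n) : measurableTypeR R := x ord0 i.

Let rV_set0 : g_sigma_preimage rV_coord set0.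
Proof. exact: sigma_algebra0. Qed.

Let rV_setC A : g_sigma_preimage rV_coord A -> g_sigma_preimage rV_coord (~` A).
Proof. exact: sigma_algebraC. Qed.

Let rV_bigcup (F : (set 'rV[R]_n)^nat) :
  (forall i, g_sigma_preimage rV_coord (F i)) ->
  g_sigma_preimage rV_coord (\bigcup_i (F i)).
Proof. exact: sigma_algebra_bigcup. Qed.

HB.instance Definition _ := @isMeasurable.Build rV_display 'rV[R]_n
  (g_sigma_preimage rV_coord) rV_set0 rV_setC rV_bigcup.

Lemma measurable_rV_coord (i : 'I_n) : measurable_fun setT (rV_coord i).
Proof.
move=> _ Y mY; rewrite setTI; apply: sub_sigma_algebra => /=.
rewrite -bigcup_seq/=; exists i => /=; first by rewrite mem_index_enum.
by exists Y => //; rewrite setTI.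
Qed.

Lemma measurable_fun_rV d (T : measurableType d) (f : T -> 'rV[R]_n) :
  (forall i, measurable_fun setT (rV_coord i \o f)) -> measurable_fun setT f.
Proof.
move=> mf _ Y mY; rewrite setTI.
have : g_sigma_preimage rV_coord `<=` [set A | measurable (f @^-1` A)].
  apply: smallest_sub.
  - split => /=.
    + by rewrite preimage_set0.
    + by move=> A mA; rewrite setTD -preimage_setC; exact: measurableC.
    + by move=> F mF; rewrite preimage_bigcup; exact: bigcup_measurable.
  - rewrite -bigcup_seq => A [i _ [B mB <-]] /=.
    by rewrite setTI -comp_preimage -[_ @^-1` _]setTI; exact: mf.
exact.
Qed.

End measurable_rV.

Section lebesgue_rV.
Context {R : realType}.

(** The identification of [R * R^n] with [R^(n+1)], along which [lebesgue_rV]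
    below is the [n]-fold product of one-dimensional Lebesgue measure. *)
Definition rV_cons n (p : measurableTypeR R * 'rV[R]_n) : 'rV[R]_n.+1 :=
  row_mx (p.1 : R)%:M p.2.

Definition rV_uncons n (x : 'rV[R]_n.+1) : measurableTypeR R * 'rV[R]_n :=
  (x ord0 ord0, rsubmx (x : 'rV[R]_(1 + n))).

Lemma rV_cons0 n a (v : 'rV[R]_n) : rV_cons (a, v) ord0 ord0 = a.
Proof. by rewrite mxE; case: splitP => // j _; rewrite mxE !ord1 eqxx mulr1n. Qed.

Lemma rV_consS n a (v : 'rV[R]_n) i :
  rV_cons (a, v) ord0 (lift ord0 i) = v ord0 i.
Proof.
rewrite mxE; case: splitP => [[] []// | j /= ij].
by congr (v _ _); apply: val_inj; case: ij.
Qed.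

Lemma rV_consK n : cancel (@rV_cons n) (@rV_uncons n).
Proof.
move=> [a v]; rewrite /rV_uncons/rV_cons/= row_mxKr; congr pair.
exact: rV_cons0.
Qed.

Lemma measurable_rV_cons n : measurable_fun setT (@rV_cons n).
Proof.
apply: measurable_fun_rV => i.
rewrite /comp /rV_coord /rV_cons.
under eq_fun do rewrite mxE.
case: splitP => j ij.
  under eq_fun do rewrite mxE !ord1 eqxx mulr1n.
  exact: measurable_fst.
exact: (measurableT_comp (measurable_rV_coord j) measurable_snd).
Qed.

Lemma measurable_rV_uncons n : measurable_fun setT (@rV_uncons n).
Proof.
apply/measurable_fun_pairP; split; first exact: measurable_rV_coord.
apply: measurable_fun_rV => i.
rewrite /comp /rV_coord /rV_uncons /=.
under eq_fun do rewrite mxE.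
exact: measurable_rV_coord.
Qed.


Section pushforward_rV_cons.
Local Open Scope ereal_scope.
Variables (n : nat) (mu : {sigma_finite_measure set 'rV[R]_n -> \bar R}).

Definition lebesgue_prod : set 'rV[R]_n.+1 -> \bar R :=
  pushforward (lebesgue_measure \x mu) (@rV_cons n).

Let lebesgue_prod0 : lebesgue_prod set0 = 0.
Proof. by rewrite /lebesgue_prod /pushforward preimage_set0 measure0. Qed.

Let lebesgue_prod_ge0 A : 0 <= lebesgue_prod A.
Proof. by apply: integral_ge0 => x _; exact: measure_ge0. Qed.

Let lebesgue_prod_sigma_additive : semi_sigma_additive lebesgue_prod.
Proof.
have mc := @measurable_rV_cons n.
exact: (@measure_semi_sigma_additive _ _ _
  (measure_function_pushforward__canonical__measure_function_Measure (lebesgue_measure \x mu) mc)).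
Qed.

HB.instance Definition _ := isMeasure.Build _ _ _ lebesgue_prod
  lebesgue_prod0 lebesgue_prod_ge0 lebesgue_prod_sigma_additive.

Let lebesgue_prod_sigma_finite : sigma_finite setT lebesgue_prod.
Proof.
have /sigma_finiteP[F [FT ndF Foo]] := sigma_finiteT (@lebesgue_measure R).
have /sigma_finiteP[G [GT ndG Goo]] := sigma_finiteT mu.
exists (fun k => (@rV_uncons n) @^-1` (F k `*` G k)).
  apply/esym; rewrite -subTset => x _.
  have : setT (rV_uncons x).1 by []. rewrite {1}FT => -[i _ Fi].
  have : setT (rV_uncons x).2 by []. rewrite {1}GT => -[j _ Gj].
  exists (maxn i j) => //; split.
  - by move: Fi; exact/subsetPset/ndF/leq_maxl.
  - by move: Gj; exact/subsetPset/ndG/leq_maxr.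
move=> k; have [mF Fk] := Foo k; have [mG Gk] := Goo k; split.
  by rewrite -[_ @^-1` _]setTI; apply: measurable_rV_uncons => //; exact: measurableX.
rewrite /lebesgue_prod /pushforward -comp_preimage.
rewrite (_ : _ \o _ = id); last by apply/funext => x; exact: rV_consK.
by rewrite preimage_id product_measure1E// lte_mul_pinfty// ge0_fin_numE.
Qed.

HB.instance Definition _ := Measure_isSigmaFinite.Build _ _ _ lebesgue_prod
  lebesgue_prod_sigma_finite.

End pushforward_rV_cons.

Fixpoint lebesgue_rV (n : nat) : {sigma_finite_measure set 'rV[R]_n -> \bar R} :=
  match n with
  | 0%N => \d_(0 : 'rV[R]_0)
  | m.+1 => lebesgue_prod (lebesgue_rV m)
  end.

Lemma lebesgue_rV_box n (A : 'I_n -> set (measurableTypeR R)) :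
  (forall i, measurable (A i)) ->
  lebesgue_rV n [set x | forall i, A i (rV_coord i x)] =
  (\prod_(i < n) lebesgue_measure (A i))%E.
Proof.
elim: n A => [|n IHn] A mA /=.
  by rewrite big_ord0 diracE mem_set// => i; have := ltn_ord i.
rewrite big_ord_recl -(IHn (A \o lift ord0))//; last by move=> i; exact: mA.
rewrite /lebesgue_prod /pushforward.
rewrite (_ : _ @^-1` _ =
  A ord0 `*` [set x | forall i, A (lift ord0 i) (rV_coord i x)]).
  rewrite product_measure1E//.
  have -> : [set x : 'rV[R]_n | forall i, A (lift ord0 i) (rV_coord i x)] =
      \bigcap_(i in [set: 'I_n]) (rV_coord i @^-1` A (lift ord0 i)).
    by apply/seteqP; split => x /= Ax i; [move=> _|]; exact: Ax.
  apply: fin_bigcap_measurable => // i _.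
  by rewrite -[_ @^-1` _]setTI; exact: measurable_rV_coord.
apply/seteqP; split=> -[a v] /=.
  move=> Aav; split=> [|i]; first by rewrite -(rV_cons0 a v); exact: Aav.
  by rewrite /rV_coord -(rV_consS a v); exact: Aav.
move=> [Aa Av] i; rewrite /rV_coord; have [j ->|->] := unliftP ord0 i.
  by rewrite rV_consS; exact: Av.
by rewrite rV_cons0.
Qed.

End lebesgue_rV.

Section euclidean.
Context {R : realType} {n : nat}.

(** The norm that the library puts on ['rV[R]_n] is the sup norm; it only
    serves for the (same) topology and for derivatives. *)
Definition enorm (x : 'rV[R]_n) : R := Num.sqrt (\sum_(i < n) x ord0 i ^+ 2).

Definition unit_ball : set 'rV[R]_n := [set x | enorm x < 1].

Definition unit_sphere : set 'rV[R]_n := [set x | enorm x = 1].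

(** Surface measure on the unit sphere, obtained from Lebesgue measure through
    polar coordinates: [sigma(E) = n * |{r y : 0 < r <= 1, y in E}|]. *)
Definition surface_measure (E : set 'rV[R]_n) : \bar R :=
  (n%:R%:E * lebesgue_rV n [set x | exists (r : R) y,
     [/\ (0 < r <= 1)%R, (unit_sphere `&` E) y & x = r *: y]])%E.

Definition partial (i : 'I_n) (f : 'rV[R]_n -> R) : 'rV[R]_n -> R :=
  fun x => 'D_(delta_mx ord0 i) f x.

Definition grad (f : 'rV[R]_n -> R) : 'rV[R]_n -> 'rV[R]_n :=
  fun x => \row_i partial i f x.

(** [C^oo]: all iterated partial derivatives exist and are continuous. *)
Definition smooth (f : 'rV[R]_n -> R) : Prop :=
  forall s : seq 'I_n,
    continuous (foldr partial f s) /\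
    forall i x, derivable (foldr partial f s) x (delta_mx ord0 i).

Definition support (f : 'rV[R]_n -> R) : set 'rV[R]_n :=
  closure [set x | f x != 0].

(** Elements of [C_c^oo(Omega)], extended by zero to [R^n]. *)
Definition test_function (Omega : set 'rV[R]_n) (phi : 'rV[R]_n -> R) : Prop :=
  [/\ smooth phi, compact (support phi) & support phi `<=` Omega].

End euclidean.

Arguments unit_ball {R} n.
Arguments unit_sphere {R} n.

(** [omega n] is the total surface measure of the unit sphere of [R^n]
    (written [omega_(n-1)] after the dimension of the sphere). *)
Definition omega (R : realType) (n : nat) : R :=
  fine (surface_measure (@unit_sphere R n)).

Definition alpha_crit (R : realType) (n : nat) : R :=
  n%:R * omega R n `^ (n%:R - 1)^-1.

Section sobolev.
Context {R : realType} {n : nat}.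
Variables (Omega : set 'rV[R]_n) (p : nat).
Implicit Types (u : 'rV[R]_n -> R) (g : 'rV[R]_n -> 'rV[R]_n).

Definition in_Lp u : Prop :=
  measurable_fun Omega u /\
  (\int[lebesgue_rV n]_(x in Omega) (`|u x| ^+ p)%:E < +oo)%E.

Definition weak_gradient u g : Prop :=
  forall (i : 'I_n) (phi : 'rV[R]_n -> R), test_function Omega phi ->
  (\int[lebesgue_rV n]_(x in Omega) (u x * partial i phi x)%:E =
   - \int[lebesgue_rV n]_(x in Omega) (g x ord0 i * phi x)%:E)%E.

(** [u] is in [W^(1,p)(Omega)] and [g] is its weak gradient.  Functions stand
    for their almost-everywhere classes; in particular [g] is determined by [u]
    up to a null set. *)
Definition W1p u g : Prop :=
  [/\ in_Lp u, forall i, in_Lp (fun x => g x ord0 i) & weak_gradient u g].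

(** The [p]-th power of the [W^(1,p)] norm of a function [u] with gradient [g]. *)
Definition W1p_normX u g : \bar R :=
  (\int[lebesgue_rV n]_(x in Omega) (`|u x| ^+ p + enorm (g x) ^+ p)%:E)%E.

(** [W^(1,p)_0(Omega)]: the closure of [C_c^oo(Omega)] in [W^(1,p)(Omega)]. *)
Definition W1p0 u g : Prop :=
  W1p u g /\
  exists phi : nat -> 'rV[R]_n -> R,
    (forall k, test_function Omega (phi k)) /\
    W1p_normX (fun x => u x - phi k x) (fun x => g x - grad (phi k) x)
      @[k --> \oo] --> 0%E.

(** Radial symmetry of an almost-everywhere class. *)
Definition radial u : Prop :=
  exists f : R -> R,
    {ae lebesgue_rV n, forall x, Omega x -> u x = f (enorm x)}.

End sobolev.

(** The functions [u] in [W^(1,n)_(0,rad)(B)] whose gradient has [L^n] norm at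
    most 1. *)
Definition W1n0rad_le1 (R : realType) (n : nat) : set ('rV[R]_n -> R) :=
  [set u | radial (unit_ball n) u /\
    exists g, W1p0 (unit_ball n) n u g /\
      (\int[lebesgue_rV n]_(x in unit_ball n) (enorm (g x) ^+ n)%:E <= 1)%E].

Arguments W1n0rad_le1 : clear implicits.

(* Main.v *)
(** The supremum is already infinite over smooth compactly supported functions.
    Let [v_a(x) = - (1/2) ln (2 (|x|^2 + a))] and [Phi(v) = v e^(-1/v)] for
    [v > 0], [Phi(v) = 0] otherwise.  Then [u = Phi o v_a] is smooth on the whole
    space, is supported in [2 |x|^2 <= 1], and as [0 <= Phi' <= 1] satisfies
    [|grad u| <= |x| / (|x|^2 + a)].  With [a = e^(-2L)], summing over thin
    spherical shells bounds [int |grad u|^n] by [|B| + (1 + eps) omega L], while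
    [u >= L - 2] on the ball of radius [e^(-L)].  After normalization the exponent
    on that ball is at least [(1 + delta) n L] when [gamma > alpha_n], which beats
    the volume [|B| e^(-n L)] as [L] tends to infinity; both perturbations only
    increase the exponent as soon as [|u| >= 1].  Taking [u] smooth rather than
    the usual truncated logarithm makes its membership in [W^(1,n)_0]
    immediate from classical integration by parts. *)

Require Import Defs.
From HB Require Import structures.
From mathcomp Require Import all_boot all_order all_algebra.
From mathcomp Require Import all_classical all_reals all_analysis.
From mathcomp Require Import measurable_realfun ring lra.
Import Order.TTheory GRing.Theory Num.Theory.
Import numFieldNormedType.Exports.
Local Open Scope classical_set_scope.
Local Open Scope ring_scope.

Set Implicit Arguments.
Unset Strict Implicit.
Unset Printing Implicit Defensive.

(** * Borel sets and scaling of Lebesgue measure on R^n *)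

Section rV_measure.
Context {R : realType}.

(** An open set is the union of the cubes with rational centre and rational radius that it contains,
    and there are only countably many of these. *)
Lemma open_measurable_rV n (U : set 'rV[R]_n) : open U -> measurable U.
Proof.
move=> oU.
pose B (p : 'rV[rat]_n * rat) : set 'rV[R]_n := [set x | forall i,
  rV_coord i x \in `]ratr (p.1 ord0 i) - ratr p.2, ratr (p.1 ord0 i) + ratr p.2[].
have mB p : measurable (B p).
  have -> : B p = \bigcap_(i in [set: 'I_n]) (rV_coord i @^-1`
      `]ratr (p.1 ord0 i) - ratr p.2, ratr (p.1 ord0 i) + ratr p.2[%classic).
    by apply/seteqP; split => x /= Bx i; [move=> _|]; exact: Bx.
  apply: fin_bigcap_measurable => // i _.
  by rewrite -[_ @^-1` _]setTI; exact: measurable_rV_coord.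
have -> : U = \bigcup_p (if `[< B p `<=` U >] then B p else set0).
  apply/seteqP; split => x.
    move=> Ux; have : nbhs x U by exact: open_nbhs_nbhs.
    move=> /nbhs_ballP[e /= e0 xeU].
    (* Points of a cube of radius [r] differ by less than [2 r] in each coordinate, so with
       [r < e / 2] a cube through [x] stays in the [e]-ball. *)
    have /rat_in_itvoo[r] : 0 < e / 2 by rewrite divr_gt0.
    rewrite in_itv/= => /andP[r0 re].
    have /choice[q qP] (i : 'I_n) : exists q : rat,
        ratr q \in `]x ord0 i - ratr r, x ord0 i + ratr r[.
      by apply: rat_in_itvoo; rewrite ltrD2l gtrN.
    exists (\row_i q i, r) => //; case: asboolP => [_ i|].
      by move: (qP i); rewrite /rV_coord !mxE !in_itv/= => /andP[? ?]; lra.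
    case=> y By; apply: xeU; split => // i j.
    rewrite ord1 /ball/= ltr_norml.
    by move: (By j) (qP j); rewrite /rV_coord !mxE !in_itv/= => /andP[? ?] /andP[? ?]; lra.
  by move=> [p _]; case: asboolP => // BU Bx; exact: BU.
apply: countable_bigcupT_measurable; first exact: countableP.
by move=> p; case: ifP.
Qed.

Lemma continuous_measurable_rV n (f : 'rV[R]_n -> R) :
  continuous f -> measurable_fun setT f.
Proof.
move=> /continuousP cf; apply: (measurability _ (RGenOpens.measurableE R)).
move=> _ [_ [a [b ->] <-]]; rewrite setTI; apply: open_measurable_rV.
exact/cf/interval_open.
Qed.

Lemma enorm_continuous n : continuous (@enorm R n).
Proof.
move=> x; rewrite /enorm.
apply: (@continuous_comp _ _ _ (fun x : 'rV[R]_n => \sum_(i < n) x ord0 i ^+ 2) Num.sqrt); last exact: sqrt_continuous.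
move: x; refine (@continuous_big R _ +%R 0 xpredT _ _ _ (fun i (x : 'rV[R]_n) => x ord0 i ^+ 2) _).
  exact: add_continuous.
move=> i _ y; apply: (@continuousM R _ (fun x : 'rV[R]_n => x ord0 i)
  (fun x : 'rV[R]_n => x ord0 i)); exact: coord_continuous.
Qed.

Lemma measurable_enorm n : measurable_fun setT (@enorm R n).
Proof. by apply: continuous_measurable_rV; exact: enorm_continuous. Qed.

End rV_measure.

Section scaling.
Context {R : realType}.

Lemma rV_consZ n (r a : R) (v : 'rV[R]_n) :
  r *: rV_cons (a, v) = rV_cons (r * a, r *: v).
Proof.
apply/rowP => i; rewrite mxE; have [j ->|->] := unliftP ord0 i.
  by rewrite !rV_consS mxE.
by rewrite !rV_cons0.
Qed.

(** The pushforward under multiplication by [r], multiplied by [r], gives every interval its length,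
    so it is Lebesgue measure by uniqueness. *)
Lemma lebesgue_measure_scale (r : R) (A : set (measurableTypeR R)) : 0 < r ->
  measurable A ->
  lebesgue_measure ((fun a : R => r * a) @^-1` A) =
  ((r^-1)%:E * lebesgue_measure A)%E.
Proof.
move=> r0 mA.
have mr : measurable_fun [set: measurableTypeR R]
  ((fun a => r * a) : measurableTypeR R -> measurableTypeR R).
  exact: measurable_funM.
pose k : {nonneg R} := NngNum (ltW r0).
have := @lebesgue_measure_unique R
  (mscale k (measure_function_pushforward__canonical__measure_function_Measure
     lebesgue_measure mr)) _ A mA.
rewrite /mscale/= /pushforward => ->; last first.
  move=> _ [[a b] _ <-]; rewrite /mscale/= /pushforward.
  have -> : (fun a => r * a) @^-1` `]a, b]%classic = `](r^-1 * a), (r^-1 * b)]%classic.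
    by apply/seteqP; split=> x /=; rewrite !in_itv/= ltr_pdivrMl// ler_pdivlMl.
  rewrite !lebesgue_measure_itv/= !lte_fin ltr_pM2l ?invr_gt0//.
  case: ifP => _; last by rewrite mule0.
  by rewrite -!EFinB -EFinM -mulrBr mulrA divff ?gt_eqF// mul1r.
by rewrite muleA -EFinM mulVf ?gt_eqF// mul1e.
Qed.

Lemma ge0_integral_scale (r : R) (f : R -> \bar R) : 0 < r ->
  measurable_fun setT f -> (forall x, 0 <= f x)%E ->
  (\int[lebesgue_measure]_a f (r * a)%R = (r^-1)%:E * \int[lebesgue_measure]_a f a)%E.
Proof.
move=> r0 mf f0.
have mr : measurable_fun [set: measurableTypeR R]
  ((fun a => r * a) : measurableTypeR R -> measurableTypeR R).
  exact: measurable_funM.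
have V0 : 0 <= r^-1 by rewrite invr_ge0 ltW.
rewrite -[RHS](ge0_integral_mscale _ _ (NngNum V0))//=.
have := @ge0_integral_pushforward _ _ _ _ R _ mr
  lebesgue_measure setT f measurableT mf (fun y _ => f0 y).
rewrite preimage_setT => <-.
apply: eq_measure_integral => A mA _.
by rewrite /pushforward/= /mscale/=; exact: lebesgue_measure_scale.
Qed.

(** Slice along the first coordinate: the induction hypothesis scales the sections, and
    [ge0_integral_scale] supplies the remaining factor [r^-1] from the outer integral. *)
Lemma lebesgue_rV_scale n (r : R) (A : set 'rV[R]_n) : 0 < r ->
  measurable A ->
  lebesgue_rV n ((fun x => r *: x) @^-1` A) =
  (((r ^+ n)^-1)%:E * lebesgue_rV n A)%E.
Proof.
move=> r0; elim: n A => [|n IHn] A mA.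
  rewrite expr0 invr1 mul1e; congr (lebesgue_rV _ _); apply/funext => x /=.
  by rewrite (_ : r *: x = x)//; apply/rowP => -[].
have mB : measurable (@rV_cons R n @^-1` A).
  by rewrite -[_ @^-1` _]setTI; exact: measurable_rV_cons.
rewrite /= /lebesgue_prod /pushforward /product_measure1.
have mg : measurable_fun [set: measurableTypeR R]
    (fun a => lebesgue_rV n (xsection (@rV_cons R n @^-1` A) a)).
  exact: measurable_fun_xsection.
have g0 a : (0 <= lebesgue_rV n (xsection (@rV_cons R n @^-1` A) a))%E by [].
rewrite exprS invfM mulrC EFinM -muleA -(ge0_integral_scale r0 mg g0).
rewrite -ge0_integralZl//; last 2 first.
- apply: (measurableT_comp mg); exact: measurable_funM.
- by rewrite lee_fin invr_ge0 exprn_ge0// ltW.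
apply: eq_integral => a _ /=; rewrite -IHn; last exact: measurable_xsection.
congr (lebesgue_rV _ _); apply/seteqP; split => v;
  by rewrite /xsection/= !inE/= rV_consZ.
Qed.

End scaling.

(** * Volume of Euclidean balls *)

Section euclidean_balls.
Context {R : realType}.

Lemma enorm_ge0 n (x : 'rV[R]_n) : 0 <= enorm x.
Proof. exact: sqrtr_ge0. Qed.

Lemma enorm_sqr n (x : 'rV[R]_n) : enorm x ^+ 2 = \sum_(i < n) x ord0 i ^+ 2.
Proof. by rewrite sqr_sqrtr// sumr_ge0// => i _; exact: sqr_ge0. Qed.

Lemma enormZ n (r : R) (x : 'rV[R]_n) : enorm (r *: x) = `|r| * enorm x.
Proof.
rewrite /enorm -sqrtr_sqr -sqrtrM ?sqr_ge0//; congr Num.sqrt.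
by rewrite mulr_sumr; apply: eq_bigr => i _; rewrite mxE exprMn.
Qed.

Lemma enorm0 n : enorm (0 : 'rV[R]_n) = 0.
Proof. by rewrite -(scale0r (0 : 'rV[R]_n)) enormZ normr0 mul0r. Qed.

Lemma enorm_eq0 n (x : 'rV[R]_n) : enorm x = 0 -> x = 0.
Proof.
move=> x0; apply/rowP => i; rewrite mxE.
have /eqP := enorm_sqr x; rewrite x0 expr0n/= eq_sym psumr_eq0; last first.
  by move=> j _; exact: sqr_ge0.
by move=> /allP /(_ i (mem_index_enum _)); rewrite sqrf_eq0 => /eqP.
Qed.

Lemma coord_le_enorm n (x : 'rV[R]_n) i : `|x ord0 i| <= enorm x.
Proof.
rewrite -sqrtr_sqr ler_wsqrtr// (bigD1 i)//= lerDl sumr_ge0// => j _.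
exact: sqr_ge0.
Qed.

Lemma measurable_eball n (r : R) : measurable [set x : 'rV[R]_n | enorm x < r].
Proof.
have -> : [set x : 'rV[R]_n | enorm x < r] = @enorm R n @^-1` `]-oo, r[%classic.
  by apply/seteqP; split => x /=; rewrite in_itv.
by rewrite -[_ @^-1` _]setTI; exact: measurable_enorm.
Qed.

Lemma measurable_unit_ball n : measurable (@unit_ball R n).
Proof. exact: measurable_eball. Qed.

Lemma lebesgue_eball n (r : R) : 0 < r ->
  lebesgue_rV n [set x | enorm x < r] =
  ((r ^+ n)%:E * lebesgue_rV n (unit_ball n))%E.
Proof.
move=> r0; have -> : unit_ball n =
    (fun x => r *: x) @^-1` [set x : 'rV[R]_n | enorm x < r].
  apply/seteqP; split=> x; rewrite /unit_ball/= enormZ gtr0_norm//.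
  - by move=> ?; rewrite gtr_pMr.
  - by rewrite gtr_pMr.
rewrite lebesgue_rV_scale//; last exact: measurable_eball.
by rewrite muleA -EFinM divff ?mul1e// gt_eqF// exprn_gt0.
Qed.

Lemma lebesgue_rV_cube n (a : R) : 0 <= a ->
  lebesgue_rV n [set x | forall i, `](- a), a[%classic (rV_coord i x)] =
  ((a *+ 2) ^+ n)%:E.
Proof.
move=> a0; rewrite (@lebesgue_rV_box R n (fun=> `](- a), a[%classic))//.
rewrite (eq_bigr (fun=> (a *+ 2)%:E)) => [|i _].
  by rewrite prodEFin prodr_const card_ord.
rewrite lebesgue_measure_itv/= lte_fin; case: ifPn => [_|].
  by rewrite -EFinB opprK mulr2n.
rewrite -leNgt => aN; suff -> : a = 0 by rewrite mul0rn.
by apply/eqP; rewrite eq_le a0 andbT; lra.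
Qed.

Lemma measurable_cube n (a : R) : measurable
  [set x : 'rV[R]_n | forall i, `](- a), a[%classic (rV_coord i x)].
Proof.
have -> : [set x : 'rV[R]_n | forall i, `](- a), a[%classic (rV_coord i x)] =
    \bigcap_(i in [set: 'I_n]) (rV_coord i @^-1` `](- a), a[%classic).
  by apply/seteqP; split => x /= Bx i; [move=> _|]; exact: Bx.
apply: fin_bigcap_measurable => // i _.
by rewrite -[_ @^-1` _]setTI; exact: measurable_rV_coord.
Qed.

Lemma lebesgue_bounded_lty n (A : set 'rV[R]_n) (r : R) : measurable A ->
  (forall x, A x -> enorm x <= r) -> (lebesgue_rV n A < +oo)%E.
Proof.
move=> mA Ar; pose a := `|r| + 1.
have a0 : 0 <= a by rewrite addr_ge0.
apply: le_lt_trans (ltry ((a *+ 2) ^+ n)).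
rewrite -lebesgue_rV_cube//; apply: le_measure; rewrite ?inE//.
  exact: measurable_cube.
move=> x Ax i; rewrite /= in_itv/= -ltr_norml /rV_coord.
apply: le_lt_trans (coord_le_enorm x i) _.
by apply: le_lt_trans (Ar _ Ax) _; rewrite ltr_pwDr// ler_norm.
Qed.

Lemma unit_ball_lty n : (lebesgue_rV n (@unit_ball R n) < +oo)%E.
Proof.
by apply: (@lebesgue_bounded_lty _ _ 1) => [|x /ltW//]; exact: measurable_unit_ball.
Qed.

Definition ball_volume n : R := fine (lebesgue_rV n (@unit_ball R n)).

Lemma ball_volumeE n : lebesgue_rV n (@unit_ball R n) = (ball_volume n)%:E.
Proof. by rewrite fineK// ge0_fin_numE// unit_ball_lty. Qed.

(** The ball contains the cube of half-side [1 / (n + 1)], whose points have squared norm at most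
    [n / (n + 1) < 1]. *)
Lemma ball_volume_gt0 n : 0 < ball_volume n.
Proof.
rewrite -lte_fin -ball_volumeE.
pose a : R := n.+1%:R^-1.
have a0 : 0 < a by rewrite invr_gt0.
apply: (@lt_le_trans _ _ ((a *+ 2) ^+ n)%:E).
  by rewrite lte_fin exprn_gt0// mulrn_wgt0.
rewrite -lebesgue_rV_cube; last exact: ltW.
apply: le_measure; rewrite ?inE; [exact: measurable_cube|exact: measurable_unit_ball|].
move=> x xa; rewrite /unit_ball/= -(@ltr_pXn2r _ 2) ?nnegrE ?enorm_ge0//.
rewrite expr1n enorm_sqr.
apply: (@le_lt_trans _ _ (\sum_(i < n) a)).
  apply: ler_sum => i _; have := xa i.
  rewrite /= in_itv/= -ltr_norml /rV_coord => xia.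
  have a1 : a <= 1 by rewrite invf_le1// ler1n.
  rewrite -real_normK ?num_real// expr2.
  by rewrite -[leRHS]mulr1 ler_pM// ltW// (lt_le_trans xia).
rewrite sumr_const card_ord -mulr_natl /a ltr_pdivrMr// mul1r.
by rewrite ltr_nat.
Qed.

(** The cone over the whole sphere in [surface_measure] is the closed unit ball without the origin,
    and it contains the open ball up to the origin, a null set. This links the energy, computed with
    volumes, to [alpha_crit], defined with [omega]. *)
Lemma ball_volume_le_omega n : (0 < n)%N -> n%:R * ball_volume n <= omega R n.
Proof.
case: n => // n _; pose B := [set x : 'rV[R]_n.+1 | enorm x <= 1] `\ 0.
have m0 : measurable [set (0 : 'rV[R]_n.+1)].
  have -> : [set (0 : 'rV[R]_n.+1)] =
      \bigcap_(i in [set: 'I_n.+1]) (rV_coord i @^-1` [set (0 : R)]).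
    apply/seteqP; split => [x /= -> i _|x /= x0]; first by rewrite /rV_coord/= mxE.
    by apply/rowP => i; rewrite mxE; exact: (x0 i I).
  apply: fin_bigcap_measurable => // i _.
  by rewrite -[_ @^-1` _]setTI; exact: measurable_rV_coord.
have mB : measurable B.
  apply: measurableD => //.
  have -> : [set x : 'rV[R]_n.+1 | enorm x <= 1] = @enorm R n.+1 @^-1` `]-oo, 1]%classic.
    by apply/seteqP; split => x /=; rewrite in_itv.
  by rewrite -[_ @^-1` _]setTI; exact: measurable_enorm.
have Boo : (lebesgue_rV n.+1 B < +oo)%E.
  by apply: (@lebesgue_bounded_lty _ _ 1) => // x [].
have zero0 : lebesgue_rV n.+1 [set (0 : 'rV[R]_n.+1)] = 0%E.
  have -> : [set (0 : 'rV[R]_n.+1)] =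
      [set x | forall i : 'I_n.+1, [set (0 : measurableTypeR R)] (rV_coord i x)].
    apply/seteqP; split => [x /= -> i|x /= x0]; first by rewrite /rV_coord/= mxE.
    by apply/rowP => i; rewrite mxE; exact: (x0 i).
  rewrite (@lebesgue_rV_box R n.+1 (fun=> [set 0]))// big_ord_recl/=.
  by rewrite lebesgue_measure_set1 mul0e.
have -> : omega R n.+1 = n.+1%:R * fine (lebesgue_rV n.+1 B).
  rewrite /omega /surface_measure.
  have -> : [set x | exists (r : R) y, [/\ 0 < r <= 1,
      (unit_sphere n.+1 `&` unit_sphere n.+1) y & x = r *: y]] = B.
    apply/seteqP; split => x.
      move=> [r [y [/andP[r0 r1] [y1 _] ->]]]; rewrite /B/= enormZ y1 mulr1 gtr0_norm//.
      split => // /(congr1 (@enorm R n.+1)).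
      by rewrite enormZ y1 mulr1 enorm0 gtr0_norm// => /eqP; rewrite gt_eqF.
    move=> [/= x1 x0]; have e0 : 0 < enorm x.
      rewrite lt_def enorm_ge0 andbT; apply: contra_notN x0 => /eqP.
      exact: enorm_eq0.
    exists (enorm x), ((enorm x)^-1 *: x); split; first by rewrite e0.
      by split; rewrite /unit_sphere/= enormZ gtr0_norm ?invr_gt0// mulVf// gt_eqF.
    by rewrite scalerA divff ?gt_eqF// scale1r.
  by rewrite fineM// ge0_fin_numE.
rewrite ler_pM2l// fine_le ?ge0_fin_numE ?unit_ball_lty//.
rewrite -[leRHS]adde0 -zero0; apply: le_trans (measureU2 _ _ _) => //.
apply: le_measure; rewrite ?inE; [exact: measurable_unit_ball|exact: measurableU|].
move=> x; rewrite /unit_ball/= => x1.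
by have [->|/eqP x0] := eqVneq x 0; [right|left; split => //=; exact: ltW].
Qed.

End euclidean_balls.

(** * Integration by parts *)

Section integration_by_parts.
Context {R : realType}.

Lemma coord_le_norm n (x : 'rV[R]_n) i : `|x ord0 i| <= `|x|.
Proof.
rewrite [leRHS]/Num.Def.normr/= mx_normrE.
exact: (le_bigmax _ (fun ij : 'I_1 * 'I_n => `|x ij.1 ij.2|) (ord0, i)).
Qed.

Lemma notin_support n (f : 'rV[R]_n -> R) x : ~ Defs.support f x -> f x = 0.
Proof.
move=> sx; apply/eqP/negPn/negP => fx; by apply: sx; exact: subset_closure.
Qed.

Lemma partial_notin_support n (f : 'rV[R]_n -> R) i x :
  ~ Defs.support f x -> partial i f x = 0.
Proof.
move=> sx; rewrite /partial -(derive_cst (0 : R) x (delta_mx ord0 i)).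
apply: near_eq_derive.
have : nbhs x (~` Defs.support f).
  by apply: open_nbhs_nbhs; split => //; rewrite openC; exact: closed_closure.
by apply: filterS => y; exact: notin_support.
Qed.

Lemma continuous_compact_bounded n (f : 'rV[R]_n -> R) (K : set 'rV[R]_n) :
  continuous f -> compact K -> (forall x, ~ K x -> f x = 0) ->
  exists C : R, forall x, `|f x| <= C.
Proof.
move=> cf cK f0.
have /compact_bounded[M [_ KM]] : compact (f @` K).
  by apply: continuous_compact => //; exact: continuous_subspaceT.
exists (Num.max 0 (M + 1)) => x; rewrite le_max.
have [Kx|Kx] := pselect (K x); last by rewrite f0// normr0 lexx.
by apply/orP; right; apply: KM; [rewrite ltrDl|exists x].
Qed.

Lemma compact_coord_bounded n (K : set 'rV[R]_n) : compact K ->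
  exists2 M : R, 0 < M & forall (x : 'rV[R]_n) i, K x -> `|x ord0 i| < M.
Proof.
move=> /compact_bounded[M [_ KM]]; exists (Num.max 0 (M + 1) + 1).
  by rewrite ltr_wpDl// le_max lexx.
move=> x i Kx; rewrite ltr_pwDr// le_max; apply/orP; right.
by apply: le_trans (coord_le_norm x i) _; apply: KM => //; rewrite ltrDl.
Qed.

Lemma integrable_bounded_cube n (g : 'rV[R]_n -> R) (M C : R) : 0 < M ->
  measurable_fun setT g -> (forall x, `|g x| <= C) ->
  (forall (x : 'rV[R]_n) i, M <= `|x ord0 i| -> g x = 0) ->
  (lebesgue_rV n).-integrable setT (EFin \o g).
Proof.
move=> M0 mg gC g0.
pose Q := [set x : 'rV[R]_n | forall i, `](- M), M[%classic (rV_coord i x)].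
have Qoo : (lebesgue_rV n Q < +oo)%E.
  by rewrite lebesgue_rV_cube ?ltry// ltW.
have -> : EFin \o g = (EFin \o g) \_ Q.
  apply/funext => x; rewrite /patch; case: ifPn => // /negP; rewrite inE => xQ.
  have [i xi] : exists i, ~ `](- M), M[%classic (rV_coord i x).
    exact/existsNP.
  rewrite /= (g0 _ i)//; move: xi; rewrite /= in_itv/= -ltr_norml => /negP.
  by rewrite -leNgt.
rewrite -integrable_mkcond; last exact: measurable_cube.
apply: measurable_bounded_integrable.
- exact: measurable_cube.
- exact: Qoo.
- exact: measurable_funTS.
- exists C; split; first exact: num_real.
  by move=> D CD x _; apply: le_trans (gC x) (ltW CD).
Qed.

Lemma rV_cons_shift0 n (t : R) (v : 'rV[R]_n) :
  rV_cons (t, v) = rV_cons (0, v) + t *: delta_mx ord0 ord0.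
Proof.
apply/rowP => i; rewrite [in RHS]mxE [X in _ = _ + X]mxE [X in _ = _ + _ * X]mxE.
have [j ->|->] := unliftP ord0 i; first by rewrite !rV_consS/= mulr0 addr0.
by rewrite !rV_cons0 !eqxx mulr1 add0r.
Qed.

Lemma rV_cons_shiftS n (a t : R) (v : 'rV[R]_n) (j : 'I_n) :
  rV_cons (a, v + t *: delta_mx ord0 j) =
  rV_cons (a, v) + t *: delta_mx ord0 (lift ord0 j).
Proof.
apply/rowP => i; rewrite [in RHS]mxE [X in _ = _ + X]mxE [X in _ = _ + _ * X]mxE.
have [k ->|->] := unliftP ord0 i.
  by rewrite !rV_consS !mxE/= (inj_eq lift_inj).
by rewrite !rV_cons0 !eqxx/= mulr0 addr0.
Qed.

(** Fubini, integrating first along direction [i]. The bounds [M] and [C] are uniform, so they pass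
    to every slice in the induction. *)
Lemma integral_lines0 n (i : 'I_n) (g : 'rV[R]_n -> R) (M C : R) : 0 < M ->
  measurable_fun setT g -> (forall x, `|g x| <= C) ->
  (forall (x : 'rV[R]_n) i, M <= `|x ord0 i| -> g x = 0) ->
  (forall x, \int[lebesgue_measure]_t (g (x + t *: delta_mx ord0 i))%:E = 0)%E ->
  (\int[lebesgue_rV n]_x (g x)%:E = 0)%E.
Proof.
move=> M0; elim: n i g => [[]//|n IHn] i g mg gC g0 gi.
have mc := @measurable_rV_cons R n.
have ig := integrable_bounded_cube M0 mg gC g0.
have igc : (lebesgue_measure \x lebesgue_rV n)%E.-integrable setT
    ((EFin \o g) \o @rV_cons R n).
  apply/integrableP; split.
    by apply: measurableT_comp => //; exact/measurable_EFinP.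
  move/integrableP : ig => [mg' ]; apply: le_lt_trans.
  have /= := @ge0_integral_pushforward _ _ _ _ R _ mc
    (lebesgue_measure \x lebesgue_rV n)%E setT (abse \o (EFin \o g)) measurableT
    (measurableT_comp (@abse_measurable R setT) mg') (fun y _ => abse_ge0 _).
  by rewrite preimage_setT => <-.
have -> : (\int[lebesgue_rV n.+1]_x (g x)%:E =
    \int[lebesgue_measure \x lebesgue_rV n]_x ((EFin \o g) \o @rV_cons R n) x)%E.
  have := @integral_pushforward _ _ _ _ R _ mc
    (lebesgue_measure \x lebesgue_rV n)%E setT (EFin \o g)
    (proj2 (measurable_EFinP _ _) mg).
  by rewrite preimage_setT => /(_ igc measurableT).
(* If [i] is not the first coordinate, freeze the first one and apply induction to the slice;
   otherwise integrate over the first coordinate innermost. *)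
have [j ij|i0] := unliftP ord0 i.
  rewrite -integral12_prod_meas1//; apply: integral0_eq => a _.
  apply: (IHn j (fun v => g (rV_cons (a, v)))) => [|v|v k|v].
  - exact: (measurableT_comp mg (measurableT_comp mc (pair1_measurable a))).
  - exact: gC.
  - by move=> Mv; apply: (g0 _ (lift ord0 k)); rewrite rV_consS.
  - rewrite -(gi (rV_cons (a, v))); apply: eq_integral => t _.
    by rewrite rV_cons_shiftS ij.
rewrite -integral21_prod_meas1//; apply: integral0_eq => v _.
rewrite -[RHS](gi (rV_cons (0, v))); apply: eq_integral => t _ /=.
by rewrite i0 -rV_cons_shift0.
Qed.

End integration_by_parts.

Section test_functions.
Context {R : realType}.

Lemma is_derive_line n (w : 'rV[R]_n -> R) (x : 'rV[R]_n) (e : 'rV[R]_n) (t : R) :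
  derivable w (x + t *: e) e ->
  is_derive t 1 (fun s : R => w (x + s *: e)) ('D_e w (x + t *: e)).
Proof.
move=> dw.
have E : (fun h : R => h^-1 *: (w (x + (h *: 1 + t) *: e) - w (x + t *: e))) =
         (fun h : R => h^-1 *: (w (h *: e + (x + t *: e)) - w (x + t *: e))).
  apply/funext => h; congr (_ *: (w _ - _)).
  by rewrite [h *: 1]mulr1 scalerDl addrCA.
apply: DeriveDef; first by rewrite /derivable/= E.
by rewrite /derive/= E.
Qed.

Lemma line_continuous n (x e : 'rV[R]_n) : continuous (fun s : R => x + s *: e).
Proof.
move=> s; apply: (@cvgD _ _ _ (nbhs s) _ (fun=> x) (fun r : R => r *: e)).
  exact: cvg_cst.
exact: scalel_continuous.
Qed.

(** The fundamental theorem of calculus on a segment of the line whose endpoints lie outside the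
    support. *)
Lemma integral_partial_line n (i : 'I_n) (w : 'rV[R]_n -> R) (x : 'rV[R]_n) :
  (forall y, derivable w y (delta_mx ord0 i)) -> continuous (partial i w) ->
  compact (Defs.support w) ->
  (\int[lebesgue_measure]_t (partial i w (x + t *: delta_mx ord0 i))%:E = 0)%E.
Proof.
move=> dw cw sw; set e := delta_mx ord0 i.
have [M M0 wM] := compact_coord_bounded sw.
(* For [|t| >= T] the [i]-th coordinate of [x + t e] has absolute value at least [M + 1], hence the
   point is outside the support. *)
pose T : R := M + `|x ord0 i| + 1.
have T0 : 0 < T by rewrite /T addr_gt0// ltr_pwDl.
have out (t : R) : T <= `|t| -> ~ Defs.support w (x + t *: e).
  move=> Tt sx; have := wM _ i sx; apply/negP; rewrite -leNgt !mxE !eqxx mulr1.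
  have := ler_normB (x ord0 i + t) (x ord0 i); rewrite [_ + t - _]addrAC subrr add0r.
  by rewrite /T in Tt; lra.
have -> : (\int[lebesgue_measure]_t (partial i w (x + t *: e))%:E =
  \int[lebesgue_measure]_(t in `[(- T)%R, T]%classic) (partial i w (x + t *: e))%:E)%E.
  rewrite [RHS]integral_mkcond; apply: eq_integral => t _.
  rewrite /patch; case: ifPn => // /negP; rewrite inE/= in_itv/= -ler_norml => /negP.
  rewrite -ltNge => /ltW /out tT; by rewrite partial_notin_support.
pose F (t : R) := w (x + t *: e).
have dF (t : R) : is_derive t 1 F (partial i w (x + t *: e)) by exact: is_derive_line.
have cF : continuous F.
  move=> t; apply: differentiable_continuous; apply/derivable1_diffP.
  exact: (@ex_derive _ _ _ _ _ _ _ (dF t)).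
rewrite (@continuous_FTC2 _ _ F); last 4 first.
- lra.
- apply: continuous_subspaceT => t.
  by apply: (@continuous_comp _ _ _ (fun s : R => x + s *: e)); [exact: line_continuous|exact: cw].
- split => [t _||].
  + exact: (@ex_derive _ _ _ _ _ _ _ (dF t)).
  + exact/cvg_at_right_filter/cF.
  + exact/cvg_at_left_filter/cF.
- by move=> t _; rewrite derive1E; exact: (@derive_val _ _ _ _ _ _ _ (dF t)).
by rewrite /F !(notin_support (out _ _)) ?normrN ?gtr0_norm// subee.
Qed.

Lemma integral_partial0 n (i : 'I_n) (w : 'rV[R]_n -> R) :
  (forall y, derivable w y (delta_mx ord0 i)) -> continuous (partial i w) ->
  compact (Defs.support w) ->
  (\int[lebesgue_rV n]_x (partial i w x)%:E = 0)%E.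
Proof.
move=> dw cw sw; have [M M0 wM] := compact_coord_bounded sw.
have [C wC] := continuous_compact_bounded cw sw
  (fun x => @partial_notin_support _ _ w i x).
apply: (integral_lines0 M0 _ wC) => [|x j Mx|x].
- exact: continuous_measurable_rV.
- apply: partial_notin_support => sx; have := wM _ j sx; apply/negP.
  by rewrite -leNgt.
- exact: integral_partial_line.
Qed.

Lemma test_function_partial_continuous n Omega (f : 'rV[R]_n -> R) i :
  test_function Omega f -> continuous (partial i f).
Proof. by move=> [/(_ [:: i])[]]. Qed.

Lemma test_function_continuous n Omega (f : 'rV[R]_n -> R) :
  test_function Omega f -> continuous f.
Proof. by move=> [/(_ [::])[]]. Qed.

Lemma test_function_derivable n Omega (f : 'rV[R]_n -> R) i x :
  test_function Omega f -> derivable f x (delta_mx ord0 i).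
Proof. by move=> [/(_ [::])[_]]. Qed.

Lemma test_function_bounded n Omega (f : 'rV[R]_n -> R) :
  test_function Omega f -> exists C : R, forall x, `|f x| <= C.
Proof.
move=> tf; have [_ cf _] := tf.
exact: (continuous_compact_bounded (test_function_continuous tf) cf
  (fun x => @notin_support _ _ f x)).
Qed.

Lemma test_function_partial_bounded n Omega (f : 'rV[R]_n -> R) i :
  test_function Omega f -> exists C : R, forall x, `|partial i f x| <= C.
Proof.
move=> tf; have [_ cf _] := tf.
exact: (continuous_compact_bounded (test_function_partial_continuous tf) cf
  (fun x => @partial_notin_support _ _ f i x)).
Qed.

Lemma bounded_integrable_ball n (g : 'rV[R]_n -> R) (C : R) :
  measurable_fun setT g -> (forall x, `|g x| <= C) ->
  (lebesgue_rV n).-integrable (unit_ball n) (EFin \o g).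
Proof.
move=> mg gC; apply: measurable_bounded_integrable.
- exact: measurable_unit_ball.
- exact: unit_ball_lty.
- exact: measurable_funTS.
- exists C; split; first exact: num_real.
  by move=> D CD x _; apply: le_trans (gC x) (ltW CD).
Qed.

Lemma bounded_in_Lp n p (g : 'rV[R]_n -> R) (C : R) :
  continuous g -> (forall x, `|g x| <= C) -> in_Lp (unit_ball n) p g.
Proof.
move=> cg gC; have mg := continuous_measurable_rV cg.
split; first exact: measurable_funTS.
have mgp : measurable_fun setT (fun x : 'rV[R]_n => `|g x| ^+ p).
  by apply: measurable_funX; exact: measurableT_comp.
have gCp x : `| (`|g x| ^+ p) | <= C ^+ p.
  by rewrite normrX normr_id lerXn2r ?nnegrE// (le_trans _ (gC x)).
have /integrableP[_] := bounded_integrable_ball mgp gCp.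
by under eq_integral do rewrite /= ger0_norm ?exprn_ge0//.
Qed.

End test_functions.

(** * Test functions belong to W^(1,p)_0 *)

Section test_functions_in_W1p0.
Context {R : realType}.

Lemma test_functionM_compact n Omega (u f : 'rV[R]_n -> R) :
  test_function Omega u -> compact (Defs.support (u * f)).
Proof.
move=> [_ cu _]; apply: subclosed_compact cu _; first exact: closed_closure.
apply: closure_subset => x /=; apply: contraNN => /eqP ux.
by rewrite /GRing.mul/= ux mul0r.
Qed.

Lemma partialM n (u f : 'rV[R]_n -> R) i :
  (forall x, derivable u x (delta_mx ord0 i)) ->
  (forall x, derivable f x (delta_mx ord0 i)) ->
  partial i (u * f) = (fun x => u x * partial i f x + partial i u x * f x).
Proof.
move=> du df; apply/funext => x; rewrite /partial deriveM//.
by rewrite [X in _ + X]mulrC.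
Qed.

(** The product [u * f] has compact support, so its partial derivative integrates to zero over the
    whole space; it vanishes off the ball because [u] is supported there. The product rule then
    gives the identity. *)
Lemma integral_by_parts_ball n (u f : 'rV[R]_n -> R) i :
  test_function (unit_ball n) u -> test_function (unit_ball n) f ->
  (\int[lebesgue_rV n]_(x in unit_ball n) (u x * partial i f x)%:E =
   - \int[lebesgue_rV n]_(x in unit_ball n) (partial i u x * f x)%:E)%E.
Proof.
move=> tu tf.
have du x := @test_function_derivable _ _ _ _ i x tu.
have df x := @test_function_derivable _ _ _ _ i x tf.
have cu := test_function_continuous tu; have cf := test_function_continuous tf.
have cdu := @test_function_partial_continuous _ _ _ _ i tu.
have cdf := @test_function_partial_continuous _ _ _ _ i tf.
have [Cu uC] := test_function_bounded tu.
have [Cf fC] := test_function_bounded tf.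
have [Cdu duC] := test_function_partial_bounded i tu.
have [Cdf dfC] := test_function_partial_bounded i tf.
have c1 : continuous (fun x => u x * partial i f x).
  by move=> x; apply: (@continuousM R _ u (partial i f)); [exact: cu|exact: cdf].
have c2 : continuous (fun x => partial i u x * f x).
  by move=> x; apply: (@continuousM R _ (partial i u) f); [exact: cdu|exact: cf].
have b1 x : `|u x * partial i f x| <= Cu * Cdf by rewrite normrM ler_pM.
have b2 x : `|partial i u x * f x| <= Cdu * Cf by rewrite normrM ler_pM.
have i1 := bounded_integrable_ball (continuous_measurable_rV c1) b1.
have i2 := bounded_integrable_ball (continuous_measurable_rV c2) b2.
have : (\int[lebesgue_rV n]_x (partial i (u * f) x)%:E = 0)%E.
  apply: integral_partial0.
  - by move=> y; exact: derivableM.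
  - rewrite partialM// => x; apply: (@continuousD _ _ _ (fun x => u x * partial i f x)).
      exact: c1.
    exact: c2.
  - exact: test_functionM_compact tu.
have -> : (\int[lebesgue_rV n]_x (partial i (u * f) x)%:E =
    \int[lebesgue_rV n]_(x in unit_ball n) (partial i (u * f) x)%:E)%E.
  rewrite [RHS]integral_mkcond; apply: eq_integral => x _.
  rewrite /patch; case: ifPn => // /negP; rewrite inE => xB.
  have sx : ~ Defs.support u x by case: tu => _ _ uB /uB.
  by rewrite partialM// (notin_support sx) (partial_notin_support _ sx) !mul0r addr0.
rewrite partialM//.
under eq_integral do rewrite EFinD.
rewrite integralD//=; last exact: measurable_unit_ball.
(* A vanishing sum of extended reals yields opposite terms once both integrals are known to be
   finite. *)
move=> /eqP; rewrite addeC => h.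
have := integrable_fin_num (@measurable_unit_ball R n) i1.
have := integrable_fin_num (@measurable_unit_ball R n) i2.
move: h => /=; case: (integral _ _ _) => //= r; case: (integral _ _ _) => //= s.
rewrite -EFinD eqe => /eqP h _ _; congr EFin.
by apply/eqP; rewrite -addr_eq0 addrC h.
Qed.

(** The constant sequence [u] approximates [u]; [0 < p] makes the integrand [0 ^+ p] of the distance
    vanish. *)
Lemma test_function_W1p0 n p (u : 'rV[R]_n -> R) : (0 < p)%N ->
  test_function (unit_ball n) u -> W1p0 (unit_ball n) p u (grad u).
Proof.
move=> p0 tu; split; last first.
  exists (fun=> u); split => //.
  rewrite (_ : (fun k => _) = (fun=> 0%E)); first exact: cvg_cst.
  apply/funext => _; apply: integral0_eq => x _.
  by rewrite !subrr enorm0 normr0 expr0n gtn_eqF// addr0.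
split.
- have [C uC] := test_function_bounded tu.
  exact: bounded_in_Lp (test_function_continuous tu) uC.
- move=> i; have [C uC] := test_function_partial_bounded i tu.
  have := bounded_in_Lp p (test_function_partial_continuous tu) uC.
  by rewrite (_ : partial i u = fun x => grad u x ord0 i)//; apply/funext => x; rewrite mxE.
- move=> i f tf; under [in RHS]eq_integral do rewrite mxE.
  exact: integral_by_parts_ball.
Qed.

End test_functions_in_W1p0.

(** * A smooth radial test function *)

Section flat_function.
Context {R : realType}.

(* The negative powers of [v] make the span of this family closed under
   differentiation. *)
Definition flat (k : nat) (v : R) : R :=
  if 0 < v then v^-1 ^+ k * expR (- v^-1) else 0.

Lemma flat_ge0 k v : 0 <= flat k v.
Proof.
rewrite /flat; case: ifPn => // v0.
by rewrite mulr_ge0// ?expR_ge0// exprn_ge0// invr_ge0 ltW.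
Qed.

Lemma flat_le0 k v : v <= 0 -> flat k v = 0.
Proof. by rewrite /flat => v0; rewrite ltNge v0. Qed.

Lemma flatS k v : flat k.+1 v = v^-1 * flat k v.
Proof. by rewrite /flat; case: ifPn => _; rewrite ?mulr0// exprS mulrA. Qed.

(** With [y = 1 / v], this is [y^(k+1) / (k+1)! <= e^y]. The bound is linear in [v], which is what
    differentiability at 0 requires. *)
Lemma flat_le k v : flat k v <= k.+1`!%:R * `|v|.
Proof.
rewrite /flat; case: ifPn => [v0|_]; last by rewrite mulr_ge0.
have y0 : 0 < v^-1 by rewrite invr_gt0.
rewrite expRN ler_pdivrMr ?expR_gt0// gtr0_norm//.
have := expR_ge1Dxn k (ltW y0).
set y := v^-1; set m := (k.+1)`!%:R => h.
have m0 : 0 < m by rewrite ltr0n fact_gt0.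
have -> : v = y^-1 by rewrite /y invrK.
have : y ^+ k.+1 / m <= expR y by apply: le_trans h; rewrite lerDr.
rewrite ler_pdivrMr// exprS => h'.
by rewrite [m * _]mulrC -mulrA ler_pdivlMl// [m * _]mulrC.
Qed.

(** Away from 0 this is the usual calculus. At 0 the difference quotient of [flat k] is [flat k.+1],
    which tends to 0 by [flat_le]. *)
Lemma is_derive_flat k v :
  is_derive v (1 : R) (flat k) (flat k.+2 v - k%:R * flat k.+1 v).
Proof.
have [v0|v0|->] := ltgtP v 0.
- rewrite !flat_le0 ?ltW// mulr0 subr0.
  apply: (@near_eq_is_derive _ _ _ (cst (0 : R))).
    by near=> w; rewrite flat_le0// ltW//; near: w; exact: lt_nbhsl.
- apply: (@near_eq_is_derive _ _ _ (fun w : R => w^-1 ^+ k * expR (- w^-1))).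
    by near=> w; rewrite /flat ifT//; near: w; exact: (lt_nbhsr v0).
  have d1 : is_derive v 1 (fun w : R => w^-1) (- v ^- 2).
    by have := @is_deriveV R id v 1 1 (lt0r_neq0 v0) (is_derive_id _ _);
      rewrite [_ *: 1]mulr1.
  have d2 := @is_deriveX _ _ (fun w : R => w^-1) k _ _ _ d1.
  have d3 := @is_deriveN _ _ _ (fun w : R => w^-1) _ _ _ d1.
  have d4 := @is_derive1_comp R expR (- (fun w : R => w^-1)) v _ _ (is_derive_expR _) d3.
  have := is_deriveM d2 d4.
  rewrite [X in is_derive _ _ X _](_ : _ = (fun w : R => w^-1 ^+ k * expR (- w^-1))).
    move=> d5; apply: is_derive_eq.
    rewrite /flat v0 -exprVn !fctE.
    set y := v^-1; set e := expR _; rewrite /GRing.scale/=.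
    by clear d2 d5; destruct k; rewrite /= !exprS; ring.
  by apply/funext => w; rewrite !fctE.
- rewrite !flat_le0// mulr0 subr0.
  have h0 : h^-1 *: (flat k (h *: (1 : R) + 0) - flat k 0) @[h --> 0^'] --> (0 : R).
    apply: (@cvg_to_0_linear _ _ (k.+2)`!%:R 1) => // h _.
    rewrite (@flat_le0 k 0)// subr0 addr0 [_ *: 1]mulr1 [_ *: _]mulrC mulrC -flatS.
    by rewrite ger0_norm ?flat_ge0// flat_le.
  apply: DeriveDef; first by apply/cvg_ex; exists 0.
  exact: cvg_lim h0.
Unshelve. all: by end_near. Qed.

Lemma flat_continuous k : continuous (flat k).
Proof.
move=> v; apply: differentiable_continuous; apply/derivable1_diffP.
exact: (@ex_derive _ _ _ _ _ _ _ (is_derive_flat k v)).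
Qed.

Lemma is_derive_id_flat0 (v : R) :
  is_derive v (1 : R) (fun w => w * flat 0 w) (flat 0 v + flat 1 v).
Proof.
apply: is_derive_eq; first exact: (is_deriveM (is_derive_id v 1) (is_derive_flat 0 v)).
rewrite mul0r subr0 /GRing.scale/= mulr1 addrC; congr (_ + _).
have [v0|v0] := ltP 0 v; last by rewrite !flat_le0// mulr0.
by rewrite flatS mulrA divff ?gt_eqF// mul1r.
Qed.

(** With [y = 1 / v] this reads [(1 + y) e^(-y) <= 1]. The left side is the derivative of
    [v e^(-1/v)], so composing with that function does not increase the gradient. *)
Lemma flat01_le1 (v : R) : flat 0 v + flat 1 v <= 1.
Proof.
rewrite /flat; case: ifPn => v0; last by rewrite addr0.
rewrite expr0 expr1 -mulrDl expRN ler_pdivrMr ?expR_gt0// mul1r.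
exact: expR_ge1Dx.
Qed.

(** From [e^(-y) >= 1 - y] at [y = 1 / v]: the smooth cutoff lowers the logarithm by at most 1. *)
Lemma id_flat0_ge (v : R) : v - 1 <= v * flat 0 v.
Proof.
rewrite /flat; case: ifPn => [v0|]; last by rewrite -leNgt mulr0; lra.
rewrite expr0 mul1r; have := expR_ge1Dx (- v^-1); rewrite -(ler_pM2l v0).
by apply: le_trans; rewrite mulrDr mulr1 mulrN divff ?gt_eqF.
Qed.

End flat_function.

Section smooth_radial.
Context {R : realType} {n : nat} (a : R).
Hypothesis a0 : 0 < a.

(** Reduces directional derivatives to derivatives of one real variable, where the chain rule
    applies. *)
Lemma is_derive_lineP (w : 'rV[R]_n -> R) (x e : 'rV[R]_n) (d : R) :
  is_derive (0 : R) 1 (fun s : R => w (x + s *: e)) d <-> is_derive x e w d.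
Proof.
have E : (fun h : R => h^-1 *: (w (x + (h *: 1 + 0) *: e) - w (x + 0 *: e))) =
         (fun h : R => h^-1 *: (w (h *: e + x) - w x)).
  apply/funext => h; congr (_ *: (w _ - w _)); last by rewrite scale0r addr0.
  by rewrite [h *: 1]mulr1 addr0 addrC.
split=> -[h1 h2]; apply: DeriveDef.
- by move: h1; rewrite /derivable/= E.
- by move: h2; rewrite /derive/= E.
- by rewrite /derivable/= E.
- by rewrite /derive/= E.
Qed.

Lemma is_derive_compR (F : R -> R) (w : 'rV[R]_n -> R) (x e : 'rV[R]_n) (c d : R) :
  is_derive (w x) (1 : R) F c -> is_derive x e w d ->
  is_derive x e (fun y => F (w y)) (c * d).
Proof.
move=> dF /is_derive_lineP dw; apply/is_derive_lineP.
apply: (@is_derive1_comp R F (fun s : R => w (x + s *: e))) => //.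
by rewrite scale0r addr0.
Qed.

Lemma is_derive_coord (x : 'rV[R]_n) (i j : 'I_n) :
  is_derive x (delta_mx ord0 i) (fun y : 'rV[R]_n => y ord0 j) (j == i)%:R.
Proof.
apply/is_derive_lineP.
rewrite (_ : (fun s : R => _) = (fun s : R => x ord0 j + s * (j == i)%:R)).
  apply: is_derive_eq.
  by rewrite /GRing.scale/= /cst; ring.
by apply/funext => s; rewrite !mxE eqxx.
Qed.

Definition qform (x : 'rV[R]_n) : R := 2 * (\sum_(j < n) x ord0 j ^+ 2 + a).

Lemma qformE x : qform x = 2 * (enorm x ^+ 2 + a).
Proof. by rewrite enorm_sqr. Qed.

Lemma qform_gt0 x : 0 < qform x.
Proof. by rewrite qformE mulr_gt0// ltr_wpDl// sqr_ge0. Qed.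

Definition logprofile (x : 'rV[R]_n) : R := - (2^-1 * ln (qform x)).

Lemma is_derive_qform (x : 'rV[R]_n) (i : 'I_n) :
  is_derive x (delta_mx ord0 i) qform (4 * x ord0 i).
Proof.
pose h (j : 'I_n) : 'rV[R]_n -> R := (fun y => y ord0 j) * (fun y => y ord0 j).
have dh j : is_derive x (delta_mx ord0 i) (h j) (2 * x ord0 j * (j == i)%:R).
  have := is_deriveM (is_derive_coord x i j) (is_derive_coord x i j).
  by move=> dj; apply: is_derive_eq; rewrite /GRing.scale/=; ring.
have dS := is_derive_sum dh.
rewrite (_ : qform = 2 \*: (\sum_(j < n) h j + cst a)); last first.
  apply/funext => y; rewrite /qform/=.
  by rewrite /GRing.add/= fct_sumE.
apply: is_derive_eq.
rewrite (bigD1 i)//= eqxx big1 => [|j /negPf ->]; last by rewrite mulr0.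
by rewrite /GRing.scale/=; ring.
Qed.

Lemma is_derive_inv_qform (x : 'rV[R]_n) (i : 'I_n) :
  is_derive x (delta_mx ord0 i) (fun y => (qform y)^-1)
    (- 4 * x ord0 i * (qform x)^-1 * (qform x)^-1).
Proof.
have := is_deriveV (f := id) (lt0r_neq0 (qform_gt0 x)) (is_derive_id (qform x) (1 : R)).
move=> /is_derive_compR /(_ (is_derive_qform x i)) h.
apply: is_derive_eq; rewrite /GRing.scale/=; field.
exact/lt0r_neq0/qform_gt0.
Qed.

Lemma is_derive_logprofile (x : 'rV[R]_n) (i : 'I_n) :
  is_derive x (delta_mx ord0 i) logprofile (- 2 * x ord0 i * (qform x)^-1).
Proof.
have := is_derive1_ln (qform_gt0 x).
move=> /is_derive_compR /(_ (is_derive_qform x i)) h.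
have h1 := @is_deriveZ _ _ _ (fun y => ln (qform y)) (- 2^-1) _ _ _ h.
rewrite (_ : logprofile = (- 2^-1) \*: (fun y => ln (qform y))).
  apply: is_derive_eq; rewrite /GRing.scale/=; field.
  exact/lt0r_neq0/qform_gt0.
by apply/funext => y; rewrite /logprofile -mulNr.
Qed.

(** A class of functions containing the test function and closed under partial derivatives. Its
    members are continuous, so smoothness follows by induction on the list of derivatives. *)
Inductive smooth_class : ('rV[R]_n -> R) -> Prop :=
| smooth_cst c : smooth_class (fun=> c)
| smooth_coord i : smooth_class (fun x => x ord0 i)
| smooth_inv : smooth_class (fun x => (qform x)^-1)
| smooth_log : smooth_class logprofile
| smooth_flat k : smooth_class (fun x => flat k (logprofile x))
| smooth_add f g of smooth_class f & smooth_class g : smooth_class (fun x => f x + g x)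
| smooth_mul f g of smooth_class f & smooth_class g : smooth_class (fun x => f x * g x).

Lemma smooth_class_derive f i : smooth_class f ->
  exists2 g, smooth_class g & forall x, is_derive x (delta_mx ord0 i) f (g x).
Proof.
elim => {f} [c|j|||k|f g cf [df cdf fd] cg [dg cdg gd]|f g cf [df cdf fd] cg [dg cdg gd]].
- exists (fun=> 0) => [|x]; [exact: smooth_cst|exact: is_derive_cst].
- exists (fun=> (j == i)%:R) => [|x]; [exact: smooth_cst|exact: is_derive_coord].
- exists (fun x : 'rV[R]_n => - 4 * x ord0 i * (qform x)^-1 * (qform x)^-1) => [|x].
    by do !apply: smooth_mul; do ?exact: smooth_inv; [exact: smooth_cst|exact: smooth_coord].
  exact: is_derive_inv_qform.
- exists (fun x : 'rV[R]_n => - 2 * x ord0 i * (qform x)^-1) => [|x].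
    by do !apply: smooth_mul; do ?exact: smooth_inv; [exact: smooth_cst|exact: smooth_coord].
  exact: is_derive_logprofile.
- exists (fun x : 'rV[R]_n => (flat k.+2 (logprofile x) + - k%:R * flat k.+1 (logprofile x)) *
      (- 2 * x ord0 i * (qform x)^-1)) => [|x].
    apply: smooth_mul; [apply: smooth_add; [|apply: smooth_mul]|do !apply: smooth_mul];
      do ?[exact: smooth_flat|exact: smooth_cst|exact: smooth_coord|exact: smooth_inv].
  rewrite mulNr; apply: is_derive_compR; first exact: is_derive_flat.
  exact: is_derive_logprofile.
- exists (fun x : 'rV[R]_n => df x + dg x) => [|x]; first exact: smooth_add.
  exact: is_deriveD.
- exists (fun x : 'rV[R]_n => f x * dg x + g x * df x) => [|x].
    by apply: smooth_add; exact: smooth_mul.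
  exact: is_deriveM.
Qed.

Lemma smooth_class_partial f i : smooth_class f -> smooth_class (partial i f).
Proof.
move=> /(smooth_class_derive i)[g cg fg].
suff -> : partial i f = g by [].
by apply/funext => x; exact: (@derive_val _ _ _ _ _ _ _ (fg x)).
Qed.

Lemma qform_continuous : continuous qform.
Proof.
move=> x; rewrite (_ : qform = fun x => 2 * (enorm x ^+ 2 + a)); last first.
  by apply/funext => y; exact: qformE.
apply: (@continuous_comp _ _ _ (@enorm R n) (fun r => 2 * (r ^+ 2 + a))).
  exact: enorm_continuous.
apply: (@continuousM R R (cst 2) (fun r => r ^+ 2 + a)); first exact: cst_continuous.
apply: (@continuousD R R R (fun r => r ^+ 2) (cst a)); last exact: cst_continuous.
exact: exprn_continuous.
Qed.

Lemma smooth_class_continuous f : smooth_class f -> continuous f.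
Proof.
have cl : continuous logprofile.
  move=> x; apply: (@continuous_comp _ _ _ qform (fun r => - (2^-1 * ln r))).
    exact: qform_continuous.
  apply: (@continuousN R R _ (fun r => 2^-1 * ln r)).
  apply: continuousM; first exact: cst_continuous.
  exact/continuous_ln/qform_gt0.
elim => {f} [c|j|||k|f g cf cf' cg cg'|f g cf cf' cg cg'] x.
- exact: cst_continuous.
- exact: coord_continuous.
- apply: (@continuous_comp _ _ _ qform (fun r => r^-1)); first exact: qform_continuous.
  by apply: inv_continuous; rewrite lt0r_neq0// qform_gt0.
- exact: cl.
- by apply: (@continuous_comp _ _ _ logprofile); [exact: cl|exact: flat_continuous].
- by apply: (@continuousD _ _ _ f g); [exact: cf'|exact: cg'].
- by apply: (@continuousM _ _ f g); [exact: cf'|exact: cg'].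
Qed.

Lemma smooth_class_smooth f : smooth_class f -> smooth f.
Proof.
move=> cf s; have {cf} : smooth_class (foldr partial f s).
  by elim: s => //= i s; exact: smooth_class_partial.
move=> cs; split; first exact: smooth_class_continuous.
move=> i x; have [g _ /(_ x) fg] := smooth_class_derive i cs.
exact: (@ex_derive _ _ _ _ _ _ _ fg).
Qed.

End smooth_radial.

(** * Lower bounds for integrals *)

Section integral_lower_bound.
Local Open Scope ereal_scope.
Context d (T : measurableType d) (R : realType) (mu : {measure set T -> \bar R}).

(* Unlike [ge0_le_integral], no measurability is required: the integral of a
   nonnegative function is a supremum over simple functions. *)
Lemma le_integral_nonmeasurable (f1 f2 : T -> \bar R) :
  (forall x, 0 <= f1 x) -> (forall x, f1 x <= f2 x) ->
  \int[mu]_x f1 x <= \int[mu]_x f2 x.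
Proof.
move=> f10 f12; have f20 x : 0 <= f2 x by exact: le_trans (f12 x).
rewrite !ge0_integralTE//; apply: ereal_sup_le => _ [h hf1 <-].
by exists h => // x; exact: le_trans (f12 x).
Qed.

(** Keeps only the contribution of [A], which will be the small ball where the test function is
    large. *)
Lemma le_cst_integral (A B : set T) (c : R) (f : T -> \bar R) :
  measurable A -> A `<=` B -> (0 <= c)%R -> (forall x, B x -> 0 <= f x) ->
  (forall x, A x -> c%:E <= f x) -> c%:E * mu A <= \int[mu]_(x in B) f x.
Proof.
move=> mA AB c0 f0 cf; rewrite -integral_cst// integral_mkcond [leRHS]integral_mkcond.
apply: le_integral_nonmeasurable => x; rewrite /patch.
  by case: ifPn => // _; rewrite lee_fin.
case: ifPn => [/set_mem xA|_]; first by rewrite mem_set; [exact: cf|exact: AB].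
by case: ifPn => // /set_mem; exact: f0.
Qed.

End integral_lower_bound.

(** * A smooth version of the Moser function *)

Section moser.
Context {R : realType} {n : nat}.
Implicit Types (a c : R) (x : 'rV[R]_n).

Definition moser a x : R := logprofile a x * flat 0 (logprofile a x).

Lemma moser_test_function a c : 0 < a ->
  test_function (unit_ball n) (fun x => c * moser a x).
Proof.
move=> a0; have cm : smooth_class a (fun x => c * moser a x).
  apply: smooth_mul; first exact: smooth_cst.
  by apply: smooth_mul; [exact: smooth_log|exact: smooth_flat].
(* Outside [K] the logarithm is nonnegative, so [logprofile] is nonpositive and [flat] vanishes. The
   factor 2 in [qform] puts [K] inside [|x|^2 <= 1/2], strictly within the ball. *)
pose K : set 'rV[R]_n := [set x | qform a x <= 1].
have KE x : K x -> enorm x < 1.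
  rewrite /K/= qformE => xK; rewrite -(@ltr_pXn2r _ 2) ?nnegrE ?enorm_ge0// expr1n.
  lra.
have sK : Defs.support (fun x => c * moser a x) `<=` K.
  have cK : closed K.
    rewrite (_ : K = qform a @^-1` [set r | r <= 1])//.
    by apply: closed_comp => [x _|]; [exact: qform_continuous|exact: closed_le].
  rewrite (closure_id K).1//; apply: closure_subset => x /=.
  apply: contraNP => /negP; rewrite -ltNge => q1.
  rewrite /moser flat_le0 ?mulr0// /logprofile oppr_le0 mulr_ge0//.
  by rewrite ln_ge0// ltW.
split.
- exact: smooth_class_smooth cm.
- have cI : compact (`[-1, 1]%classic : set R) by exact: segment_compact.
  have cc := @rV_compact R n (fun=> (`[-1, 1]%classic : set R)) (fun=> cI).
  apply: subclosed_compact cc _; first exact: closed_closure.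
  move=> x /sK /KE x1 i; rewrite /= in_itv/= -ler_norml.
  exact: le_trans (coord_le_enorm x i) (ltW x1).
- by move=> x /sK /KE.
Qed.

Lemma grad_moser a c x : 0 < a ->
  grad (fun x => c * moser a x) x =
  (c * ((flat 0 (logprofile a x) + flat 1 (logprofile a x)) * (- 2 * (qform a x)^-1))) *: x.
Proof.
move=> a0; apply/rowP => i; rewrite !mxE.
have dm := is_derive_compR (is_derive_id_flat0 (logprofile a x)) (is_derive_logprofile a0 x i).
have dc := @is_deriveZ _ _ _ _ c _ _ _ dm.
rewrite /partial (_ : (fun _ => _) = c \*: (fun y => logprofile a y * flat 0 (logprofile a y)))//.
by rewrite (@derive_val _ _ _ _ _ _ _ dc) /GRing.scale/=; ring.
Qed.

(** The gradient is radial: the outer derivative is at most 1 by [flat01_le1], and the logarithm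
    contributes [2 |x| / qform]. *)
Lemma enorm_grad_moser a c x : 0 < a -> 0 <= c ->
  enorm (grad (fun x => c * moser a x) x) <= c * (enorm x / (enorm x ^+ 2 + a)).
Proof.
move=> a0 c0; rewrite grad_moser// enormZ.
have s0 : 0 < enorm x ^+ 2 + a by rewrite ltr_wpDl// sqr_ge0.
rewrite (_ : c * (enorm x / _) = c * (enorm x ^+ 2 + a)^-1 * enorm x); last first.
  by rewrite -mulrA [_^-1 * _]mulrC.
 apply: ler_pM => //; first exact: enorm_ge0. 
rewrite normrM (ger0_norm c0) normrM; apply: ler_wpM2l => //.
rewrite ger0_norm ?addr_ge0 ?flat_ge0//.
have -> : `|- 2 * (qform a x)^-1| = (enorm x ^+ 2 + a)^-1.
  rewrite qformE normrM normrN invfM normrM !gtr0_norm ?invr_gt0//.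
  by rewrite mulrA divff ?mul1r.
rewrite -[leRHS]mul1r; apply: ler_pM => //; last exact: flat01_le1.
  by rewrite addr_ge0 ?flat_ge0.
by rewrite invr_ge0 ltW.
Qed.

(** On this ball [qform] is at most [4 e^(-2L) <= e^(2-2L)], so [logprofile >= L - 1]; the cutoff
    costs one more unit by [id_flat0_ge]. *)
Lemma moser_ge (L : R) x : enorm x < expR (- L) ->
  L - 2 <= moser (expR (- L) ^+ 2) x.
Proof.
move=> xL; apply: le_trans (id_flat0_ge _).
suff : L - 1 <= logprofile (expR (- L) ^+ 2) x by lra.
set a := expR _ ^+ 2.
have a0 : 0 < a by rewrite exprn_gt0// expR_gt0.
have q0 := qform_gt0 a0 x.
have : ln (qform a x) <= 2 - L *+ 2.
  rewrite -ler_expR lnK ?posrE// qformE.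
  have : enorm x ^+ 2 <= a by rewrite /a lerXn2r ?nnegrE ?enorm_ge0 ?expR_ge0// ltW.
  have -> : expR (2 - L *+ 2) = expR 1 * expR 1 * a.
    by rewrite /a expr2 -!expRD; congr expR; rewrite mulr2n; ring.
  have := expR_ge1Dx (1 : R) => e2 xa.
  apply: (@le_trans _ _ (4 * a)); first lra.
  have h : 2 * 2 <= expR 1 * expR 1 :> R by apply: ler_pM => //; lra.
  by rewrite ler_pM2r//; lra.
by rewrite /logprofile => h; lra.
Qed.

End moser.

(** * Energy of the test function *)

Section energy.
Context {R : realType} {n : nat}.
Implicit Types (f : 'rV[R]_n -> R).

(* The integral is split over the shells [r l^j <= |x| < r l^(j+1)], each of which
   contributes at most [|B| (l^n - 1)]. *)
Lemma shell_energy f (r l : R) (k : nat) : 0 < r -> 1 <= l ->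
  measurable_fun setT f -> (forall x, 0 <= f x) ->
  (forall x, enorm x < r -> f x <= r^-1) -> (forall x, f x * enorm x <= 1) ->
  (\int[lebesgue_rV n]_(x in [set x | (enorm x < r * l ^+ k)%R]) (f x ^+ n)%:E <=
   (ball_volume n * (1 + k%:R * (l ^+ n - 1)))%:E)%E.
Proof.
move=> r0 l1 mf f0 fr f1.
have mfn : measurable_fun setT (fun x => (f x ^+ n)%:E).
  by apply/measurable_EFinP; exact: measurable_funX.
have fn0 (x : 'rV[R]_n) : (0 <= (f x ^+ n)%:E)%E by rewrite lee_fin exprn_ge0.
have l0 : 0 < l by exact: lt_le_trans l1.
have Icst (A : set 'rV[R]_n) (v : R) : measurable A ->
    (\int[lebesgue_rV n]_(x in A) v%:E = v%:E * lebesgue_rV n A)%E.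
  by move=> mA; exact: integral_cst.
(* The innermost ball, where [f <= r^-1], contributes at most [r^(-n) r^n |B| = |B|]. *)
elim: k => [|k IHk].
  rewrite expr0 mulr1 mul0r addr0 mulr1.
  apply: (@le_trans _ _ (\int[lebesgue_rV n]_(x in [set x | (enorm x < r)%R])
      ((r ^+ n)^-1)%:E)%E).
    apply: ge0_le_integral => //; first exact: measurable_eball.
      exact: measurable_funTS.
    move=> x xr; rewrite lee_fin -exprVn lerXn2r ?nnegrE ?invr_ge0 ?(ltW r0)//.
    exact: fr.
  rewrite Icst; last exact: measurable_eball.
  rewrite lebesgue_eball// ball_volumeE -!EFinM lee_fin mulrA mulVf ?mul1r//.
  by rewrite gt_eqF// exprn_gt0.
set s := r * l ^+ k in IHk *.
have s0 : 0 < s by rewrite mulr_gt0// exprn_gt0.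
have -> : r * l ^+ k.+1 = s * l by rewrite exprSr mulrA.
clearbody s; have sl : s <= s * l by rewrite ler_peMr// ltW.
pose B (q : R) := [set x : 'rV[R]_n | enorm x < q].
have BB : B s `<=` B (s * l) by move=> x; rewrite /B/= => /lt_le_trans; exact.
have mB q : measurable (B q) by exact: measurable_eball.
have -> : [set x : 'rV[R]_n | enorm x < s * l] = B s `|` (B (s * l) `\` B s).
  by rewrite (setDUK BB).
rewrite ge0_integral_setU//; last 3 first.
- exact: measurableD.
- exact: measurable_funTS.
- by apply/disj_setPS => x [Bx [_ /(_ Bx)]].
have -> : ball_volume n * (1 + k.+1%:R * (l ^+ n - 1)) =
    ball_volume n * (1 + k%:R * (l ^+ n - 1)) + ball_volume n * (l ^+ n - 1) :> R.
  by rewrite -natr1; ring.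
rewrite EFinD; apply: (leeD IHk).
(* On the shell [f <= 1 / |x| <= 1 / s], and the volume of the shell is [s^n (l^n - 1) |B|]. *)
apply: (@le_trans _ _ (\int[lebesgue_rV n]_(x in B (s * l)%R `\` B s) ((s ^+ n)^-1)%:E)%E).
  apply: ge0_le_integral => //; first exact: measurableD.
    exact: measurable_funTS.
  move=> x [_ /negP]; rewrite -leNgt => sx.
  rewrite lee_fin -exprVn lerXn2r ?nnegrE ?invr_ge0 ?(ltW s0)//.
  rewrite -div1r ler_pdivlMr//; apply: le_trans (f1 x).
  by rewrite ler_wpM2l.
rewrite Icst; last exact: measurableD.
have sl0 : 0 < s * l by rewrite mulr_gt0.
have Bfin (q : R) : 0 < q -> lebesgue_rV n (B q) = (q ^+ n * ball_volume n)%:E.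
  by move=> q0; rewrite lebesgue_eball// ball_volumeE EFinM.
have -> : lebesgue_rV n (B (s * l) `\` B s) =
    (lebesgue_rV n (B (s * l)%R) - lebesgue_rV n (B s))%E.
  have Boo : (lebesgue_rV n (B (s * l)%R) < +oo)%E by rewrite Bfin ?ltry.
  by have := @measureD _ _ _ (lebesgue_rV n) _ _ (mB (s * l)) (mB s) Boo; rewrite (setIidr BB).
rewrite !Bfin// -EFinB -EFinM lee_fin exprMn le_eqVlt.
apply/orP; left; apply/eqP.
have : s ^+ n != 0 by rewrite expf_neq0// gt_eqF.
by move: (s ^+ n) => q q0; field.
Qed.

(** Apply [shell_energy] with [r = e^(-k t)] and [l = e^t], so that [r l^k = 1] and the [k] shells
    fill the unit ball. *)
Lemma moser_energy (t c : R) (k : nat) : 0 < t -> 0 <= c ->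
  (\int[lebesgue_rV n]_(x in unit_ball n)
    (enorm (grad (fun x => c * moser (expR (- (k%:R * t)) ^+ 2) x) x) ^+ n)%:E <=
   (c ^+ n * (ball_volume n * (1 + k%:R * (expR (n%:R * t) - 1))))%:E)%E.
Proof.
move=> t0 c0; set r := expR (- _); set u := (fun x => c * moser _ x).
have r0 : 0 < r by exact: expR_gt0.
have a0 : 0 < r ^+ 2 by rewrite exprn_gt0.
(* This radial majorant of the gradient is at most [1 / r] for [s < r], and [s h(s) <= 1]
   everywhere. *)
pose h (s : R) := s * (s ^+ 2 + r ^+ 2)^-1.
have p0 (s : R) : 0 < s ^+ 2 + r ^+ 2 by rewrite ltr_wpDl// sqr_ge0.
pose f (x : 'rV[R]_n) := h (enorm x).
have mf : measurable_fun setT f.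
  apply: continuous_measurable_rV => x; apply: (@continuous_comp _ _ _ (@enorm R n) h).
    exact: enorm_continuous.
  apply: (@continuousM R R id (fun s => (s ^+ 2 + r ^+ 2)^-1)); first exact: cvg_id.
  apply: (@continuous_comp _ _ _ (fun s : R => s ^+ 2 + r ^+ 2) (fun s => s^-1)).
    apply: (@continuousD R R R (fun s => s ^+ 2) (cst (r ^+ 2))); last exact: cst_continuous.
    exact: exprn_continuous.
  by apply: inv_continuous; rewrite gt_eqF.
have f0 x : 0 <= f x by rewrite mulr_ge0 ?enorm_ge0// invr_ge0 ltW.
have tu := moser_test_function c a0 : test_function (@unit_ball R n) u.
have mg : measurable_fun setT (fun x : 'rV[R]_n => enorm (grad u x)).
  apply: (measurableT_comp (@measurable_enorm R n)).
  apply: measurable_fun_rV => i.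
  rewrite (_ : _ \o _ = partial i u); last by apply/funext => x; rewrite /rV_coord/= mxE.
  by apply: continuous_measurable_rV; exact: test_function_partial_continuous tu.
apply: (@le_trans _ _ (\int[lebesgue_rV n]_(x in unit_ball n)
    ((c ^+ n)%:E * (f x ^+ n)%:E))%E).
  apply: ge0_le_integral.
  - exact: measurable_unit_ball.
  - by move=> x _; rewrite lee_fin exprn_ge0// enorm_ge0.
  - apply/measurable_EFinP; apply: measurable_funX; exact: measurable_funTS.
  - apply: measurable_funeM; apply/measurable_EFinP; apply: measurable_funX.
    exact: measurable_funTS.
  - move=> x _; rewrite -EFinM lee_fin -exprMn lerXn2r ?nnegrE ?enorm_ge0 ?(mulr_ge0 c0 (f0 x))//.
    exact: enorm_grad_moser.
rewrite ge0_integralZl//; last 4 first.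
- exact: measurable_unit_ball.
- apply/measurable_EFinP; apply: measurable_funX; exact: measurable_funTS.
- by move=> x _; rewrite lee_fin exprn_ge0.
- by rewrite lee_fin exprn_ge0.
rewrite EFinM lee_wpmul2l ?lee_fin ?exprn_ge0//.
have l1 : 1 <= expR t by rewrite -expR0 ler_expR ltW.
have fr x : enorm x < r -> f x <= r^-1.
  move=> xr; rewrite /f /h ler_pdivrMr// mulrC ler_pdivlMr//.
  apply: (@le_trans _ _ (r ^+ 2)); last by rewrite lerDr sqr_ge0.
  by rewrite expr2 ler_wpM2r// ltW.
have f1 x : f x * enorm x <= 1.
  by rewrite /f /h mulrAC -expr2 ler_pdivrMr// mul1r lerDl ltW.
have := shell_energy k r0 l1 mf f0 fr f1.
rewrite expRM_natl; congr (_ <= _)%E; congr integral.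
apply/seteqP; split=> x; rewrite /unit_ball/= /r -expRM_natl -expRD addNr expR0//.
Qed.

End energy.

(** * Choice of the parameters *)

Section growth.
Context {R : realType}.

(** Bernoulli's inequality for [(1 - 2/L)^(k+1)], multiplied by [L^(k+1)]. *)
Lemma bernoulli_sub2 (L : R) k : 2 <= L ->
  L ^+ k * (L - k.+1%:R * 2) <= (L - 2) ^+ k.+1.
Proof.
move=> L2; elim: k => [|k IH]; first by rewrite mul1r expr1 mul1r.
rewrite [leRHS]exprS; apply: (@le_trans _ _ ((L - 2) * (L ^+ k * (L - k.+1%:R * 2)))); last first.
  by rewrite ler_wpM2l// subr_ge0.
rewrite exprS -subr_ge0 -natr1.
rewrite (_ : _ - _ = 4 * (k%:R + 1) * L ^+ k); last by rewrite -natr1; ring.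
by rewrite !mulr_ge0 ?exprn_ge0//; lra.
Qed.

Lemma expR_sub1_le (y : R) : expR y - 1 <= y * expR y.
Proof.
have := expR_ge1Dx (- y); rewrite expRN -(ler_pM2r (expR_gt0 y)) mulVf ?gt_eqF ?expR_gt0//.
by rewrite mulrDl mul1r mulNr; lra.
Qed.

Lemma exists_natr_gt (x : R) : exists k : nat, x < k%:R.
Proof.
exists (Num.bound `|x|); apply: le_lt_trans (ler_norm x) _.
by apply: archi_boundP.
Qed.

Lemma powR_divr_exprn (S : R) (n m : nat) : (0 < m)%N -> 0 <= S ->
  (S `^ (n%:R / m%:R)) ^+ m = S ^+ n.
Proof.
move=> m0 S0; rewrite -powR_mulrn ?powR_ge0// -powRrM mulfVK ?powR_mulrn//.
by rewrite pnatr_eq0 -lt0n.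
Qed.

(** Raising to the power [n.+1], the dimension minus one, removes the root in [alpha_crit]. *)
Lemma alpha_crit_exprn n (gamma : R) : alpha_crit R n.+2 < gamma ->
  0 < gamma /\ n.+2%:R ^+ n.+1 * omega R n.+2 < gamma ^+ n.+1.
Proof.
have w0 : 0 <= omega R n.+2.
  apply: le_trans (@ball_volume_le_omega R n.+2 isT).
  by rewrite mulr_ge0// ltW// ball_volume_gt0.
rewrite /alpha_crit (_ : n.+2%:R - 1 = n.+1%:R); last by rewrite -natr1; ring.
move=> ga; have a0 : 0 <= n.+2%:R * omega R n.+2 `^ n.+1%:R^-1.
  by rewrite mulr_ge0// powR_ge0.
have g0 := le_lt_trans a0 ga; split=> //.
have := ga; rewrite -(@ltr_pXn2r _ n.+1) ?nnegrE// ?(ltW g0)// exprMn.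
by rewrite -[n.+1%:R^-1]mul1r -[1]/(1%:R) powR_divr_exprn// expr1.
Qed.

(* Here [q = e^(n t)] and [D] is the energy bound of [moser_energy] for
   [k t = L]: the normalized plateau value is [S = (L - 2) / D^(1/n)]. *)
Lemma moser_parameters n (gamma V w : R) (A : R) : 0 < V -> 0 < w ->
  n.+2%:R * V <= w -> 0 < gamma -> n.+2%:R ^+ n.+1 * w < gamma ^+ n.+1 ->
  exists (t : R) (k : nat) (S c : R), let L := k%:R * t in
  [/\ 0 < t, 0 <= c &
      c ^+ n.+2 * (V * (1 + k%:R * (expR (n.+2%:R * t) - 1))) <= 1] /\
  [/\ 1 <= S, 0 <= L, S <= c * (L - 2) &
      A <= expR (gamma * S `^ (n.+2%:R / n.+1%:R)) * (expR (- L) ^+ n.+2 * V)].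
Proof.
move=> V0 w0 Vw g0 gw; set N : R := n.+2%:R in Vw gw *; set G := gamma ^+ n.+1 in gw.
have N0 : 0 < N by rewrite ltr0n.
have N1 : 1 <= N by rewrite ler1n.
have Nw0 : 0 < N ^+ n.+1 * w by rewrite mulr_gt0// exprn_gt0.
have G0 : 0 < G by exact: lt_trans gw.
(* [Q > 1] measures how far [gamma] is above the critical value. The choice of [t] makes
   [e^((n+1) t) e^(N t) = Q^(1/2)], so the losses from the shell width and from the factor [e^t] in
   the exponent use only half of it on the logarithmic scale. *)
pose Q := G / (N ^+ n.+1 * w).
have Q1 : 1 < Q by rewrite ltr_pdivlMr// mul1r.
pose t := ln Q / (2 * (n.+1%:R + N)).
have lnQ : 0 < ln Q by rewrite ln_gt0.
have t0 : 0 < t by rewrite divr_gt0// mulr_gt0// addr_gt0.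
pose q := expR (N * t).
pose C := (expR t * N) ^+ n.+1.
have C0 : 0 < C by rewrite exprn_gt0// mulr_gt0// expR_gt0.
have q0 : 0 < q by exact: expR_gt0.
have CG : C * (w * q) < G.
  have -> : C * (w * q) = (N ^+ n.+1 * w) * expR (ln Q / 2).
    have -> : ln Q / 2 = n.+1%:R * t + N * t.
      by rewrite /t; field; rewrite gt_eqF// addr_gt0.
    by rewrite expRD expRM_natl /C exprMn -/q; ring.
  rewrite mulrC -ltr_pdivlMr// -/Q -[ltRHS](@lnK _ Q) ?posrE ?(lt_trans _ Q1)//.
  by rewrite ltr_expR; lra.
(* Each summand serves one requirement on [L]: the first gives [key], [gamma] gives [1 <= S], 3
   keeps [L - 2] positive, and the last lets [V t L] exceed [|A|]. *)
pose bnd := (2 * N * G + C * V) / (G - C * (w * q)) + gamma + 3 + `|A| / (V * t).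
have [k kt] := exists_natr_gt (bnd / t).
have [L LE] : exists L, L = k%:R * t by exists (k%:R * t).
have Lb : bnd < L by rewrite LE -ltr_pdivrMr.
have GC0 : 0 < G - C * (w * q) by rewrite subr_gt0.
have b1 : 0 <= (2 * N * G + C * V) / (G - C * (w * q)).
  by rewrite ltW// divr_gt0// addr_gt0// !mulr_gt0.
have b2 : 0 <= `|A| / (V * t) by rewrite divr_ge0// ltW// mulr_gt0.
have L3 : 3 < L by apply: le_lt_trans Lb; rewrite /bnd; lra.
have Lg : gamma < L by apply: le_lt_trans Lb; rewrite /bnd; lra.
have LA : `|A| / (V * t) < L by apply: le_lt_trans Lb; rewrite /bnd; lra.
have LG : (2 * N * G + C * V) / (G - C * (w * q)) < L by apply: le_lt_trans Lb; rewrite /bnd; lra.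
have L0 : 0 < L by lra.
pose D := V * (1 + k%:R * (q - 1)).
have q1 : 1 < q by rewrite /q -expR0 ltr_expR mulr_gt0.
have D0 : 0 < D.
  by rewrite mulr_gt0// ltr_pwDl// mulr_ge0// subr_ge0 ltW.
(* Uses [q - 1 <= N t q], then [k t = L] and [N V <= w]. *)
have DV : D <= V + w * L * q.
  rewrite /D mulrDr mulr1 lerD2l.
  apply: (@le_trans _ _ (V * (k%:R * (N * t * q)))).
    by rewrite ler_wpM2l ?(ltW V0)// ler_wpM2l// expR_sub1_le.
  have -> : V * (k%:R * (N * t * q)) = N * V * L * q by rewrite LE; ring.
  by rewrite ler_wpM2r ?(ltW q0)// ler_wpM2r ?(ltW L0).
(* This is [D^(-1/N)], which normalizes the energy bound to 1. *)
pose c := expR (- (ln D / N)).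
have c0 : 0 < c by exact: expR_gt0.
have cD : c ^+ n.+2 = D^-1.
  rewrite /c -expRM_natl -/N (_ : N * - (ln D / N) = - ln D); last first.
    by field; rewrite gt_eqF.
  by rewrite expRN lnK.
pose S := c * (L - 2).
have S0 : 0 < S by rewrite mulr_gt0//; lra.
(* After raising to the power [n.+1] the claim is [D C L^(n+1) <= G (L - 2)^(n+2)]. Bernoulli and
   [DV] reduce it to [C (V + w L q) <= G (L - 2 N)], which is [LG]. *)
have key : expR t * N * L <= gamma * S `^ (n.+2%:R / n.+1%:R).
  have z0 : 0 <= expR t * N * L by rewrite ltW// !mulr_gt0 ?expR_gt0.
  rewrite -(@ler_pXn2r _ n.+1) ?nnegrE ?z0 ?(mulr_ge0 (ltW g0)) ?powR_ge0//.
  rewrite [leRHS]exprMn powR_divr_exprn ?(ltW S0)// -/G exprMn -/C /S exprMn cD.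
  rewrite [leRHS]mulrCA ler_pdivlMl//.
  apply: (@le_trans _ _ (G * (L ^+ n.+1 * (L - N * 2)))); last first.
    by rewrite ler_wpM2l ?(ltW G0)// bernoulli_sub2//; lra.
  have -> : D * (C * L ^+ n.+1) = L ^+ n.+1 * (C * D) by ring.
  rewrite [leRHS]mulrCA.
  apply: ler_wpM2l; first by rewrite exprn_ge0// ltW.
  apply: (@le_trans _ _ (C * (V + w * L * q))); first by rewrite ler_wpM2l// ltW.
  move: LG; rewrite ltr_pdivrMr// => LG.
  by nra.
(* If [S < 1], then [key] gives [L <= e^t N L <= gamma], against [gamma < L]. *)
have S1 : 1 <= S.
  rewrite leNgt; apply/negP => S1.
  have : S `^ (n.+2%:R / n.+1%:R) <= 1.
    apply: (@le_trans _ _ (1 `^ (n.+2%:R / n.+1%:R))); last by rewrite powR1.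
    by apply: ge0_ler_powR; rewrite ?nnegrE ?divr_ge0 ?(ltW S0) ?(ltW S1).
  rewrite -(ler_pM2l g0) mulr1 => /(le_trans key).
  have : 1 <= expR t * N by rewrite mulr_ege1// -expR0 ler_expR ltW.
  by rewrite -(ler_pM2r L0) mul1r; lra.
exists t, k, S, c; split; split; rewrite -?LE ?(ltW c0) ?(ltW L0)//.
  by rewrite cD -/q -/D mulVf// gt_eqF.
apply: (@le_trans _ _ (expR (expR t * N * L) * (expR (- L) ^+ n.+2 * V))); last first.
  apply: ler_wpM2r; last by rewrite ler_expR.
  by rewrite mulr_ge0 ?exprn_ge0 ?expR_ge0// ltW.
rewrite -expRM_natl -/N mulrA -expRD.
(* What remains of the exponent after the volume factor [e^(-N L)] is [N L (e^t - 1) >= L t], which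
   grows with [L]. *)
have h1 : L * t <= expR t * N * L + N * - L.
  have -> : expR t * N * L + N * - L = N * L * (expR t - 1) by ring.
  apply: (@le_trans _ _ (L * (expR t - 1))).
    by apply: ler_wpM2l; [exact: ltW|have := expR_ge1Dx t; lra].
  by rewrite ler_wpM2r ?subr_ge0 ?ler_peMl ?(ltW L0)// -expR0 ler_expR ltW.
apply: (@le_trans _ _ (L * t * V)).
  apply: le_trans (ler_norm A) _.
  by move: LA; rewrite ltr_pdivrMr ?(mulr_gt0 V0 t0)// => /ltW; rewrite [V * t]mulrC mulrA.
rewrite ler_wpM2r ?(ltW V0)//; apply: le_trans h1 _.
by apply: le_trans (expR_ge1Dx _); rewrite lerDr.
Qed.

End growth.

(** * Blow-up of the exponential integrals *)

Section blowup.
Context {R : realType}.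

Lemma moser_W1n0rad n (t c : R) (k : nat) : (0 < n)%N -> 0 < t -> 0 <= c ->
  c ^+ n * (ball_volume n * (1 + k%:R * (expR (n%:R * t) - 1))) <= 1 ->
  W1n0rad_le1 R n (fun x => c * moser (expR (- (k%:R * t)) ^+ 2) x).
Proof.
move=> n0 t0 c0 cle; set a := expR _ ^+ 2; split.
  exists (fun r => let v := - (2^-1 * ln (2 * (r ^+ 2 + a))) in c * (v * flat 0 v)).
  by apply: aeW => x _; rewrite /moser /logprofile qformE.
exists (grad (fun x => c * moser a x)); split.
  apply: test_function_W1p0 => //; apply: moser_test_function.
  by rewrite exprn_gt0// expR_gt0.
by apply: le_trans (moser_energy k t0 c0) _; rewrite lee_fin.
Qed.

(** Records all that the blow-up uses: for any target [A], an admissible function at least [S] on a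
    ball so that the plateau alone contributes [A]. *)
Lemma W1n0rad_plateau n (gamma A : R) : alpha_crit R n.+2 < gamma ->
  exists u (S r : R), [/\ W1n0rad_le1 R n.+2 u, 0 < r <= 1, 1 <= S,
    forall x, enorm x < r -> S <= `|u x| &
    A <= expR (gamma * S `^ (n.+2%:R / n.+1%:R)) * (r ^+ n.+2 * ball_volume n.+2)].
Proof.
move=> /alpha_crit_exprn[g0 gw].
have Vw := @ball_volume_le_omega R n.+2 isT.
have V0 := @ball_volume_gt0 R n.+2.
have w0 : 0 < omega R n.+2 by apply: lt_le_trans Vw; rewrite mulr_gt0.
have [t [k [S [c [[t0 c0 cE] [S1 L0 SL AS]]]]]] := moser_parameters A V0 w0 Vw g0 gw.
exists (fun x => c * moser (expR (- (k%:R * t)) ^+ 2) x), S, (expR (- (k%:R * t))).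
split => //; first exact: moser_W1n0rad.
  by rewrite expR_gt0 -[leRHS]expR0 ler_expR oppr_le0.
move=> x xr; apply: le_trans SL _; apply: le_trans (ler_norm _).
by rewrite ler_wpM2l// moser_ge.
Qed.

(** The exponent [F] is left abstract so that both perturbed functionals are covered; it only has to
    dominate the unperturbed exponent where [|u| >= S >= 1]. *)
Lemma ereal_sup_exp_plateau n (gamma : R) (F : ('rV[R]_n.+2 -> R) -> 'rV[R]_n.+2 -> R) :
  alpha_crit R n.+2 < gamma ->
  (forall u x (S : R), 1 <= S -> S <= `|u x| ->
    gamma * S `^ (n.+2%:R / n.+1%:R) <= F u x) ->
  ereal_sup [set (\int[lebesgue_rV n.+2]_(x in unit_ball n.+2) (expR (F u x))%:E)%E
    | u in W1n0rad_le1 R n.+2] = +oo%E.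
Proof.
move=> ga FS; apply/eqyP => A _.
have [u [S [r [uW /andP[r0 r1] S1 Su AS]]]] := W1n0rad_plateau A ga.
apply: (@le_trans _ _ (\int[lebesgue_rV n.+2]_(x in unit_ball n.+2) (expR (F u x))%:E)%E).
  apply: (@le_trans _ _ ((expR (gamma * S `^ (n.+2%:R / n.+1%:R)))%:E *
      lebesgue_rV n.+2 [set x : 'rV[R]_n.+2 | (enorm x < r)%R])%E).
    by rewrite lebesgue_eball// ball_volumeE -!EFinM lee_fin.
  apply: le_cst_integral => //.
  - exact: measurable_eball.
  - by move=> x /lt_le_trans; exact.
  - by move=> x xr; rewrite lee_fin ler_expR; apply: FS => //; exact: Su.
by apply: ereal_sup_ubound; exists u.
Qed.

End blowup.

Theorem lemma1p2 (R : realType) (alpha : R) (n : nat) :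
  0 < alpha -> (2 <= n)%N ->
  forall gamma : R, alpha_crit R n < gamma ->
  ereal_sup [set (\int[lebesgue_rV n]_(x in unit_ball n)
      (expR ((gamma + enorm x `^ alpha) *
             `|u x| `^ (n%:R / (n%:R - 1))))%:E)%E
    | u in W1n0rad_le1 R n] = +oo%E
  /\
  ereal_sup [set (\int[lebesgue_rV n]_(x in unit_ball n)
      (expR (gamma *
             `|u x| `^ (n%:R / (n%:R - 1) + enorm x `^ alpha)))%:E)%E
    | u in W1n0rad_le1 R n] = +oo%E.
Proof.
move=> _; case: n => [//|[//|n]] _ gamma ga.
have [g0 _] := alpha_crit_exprn ga.
have -> : n.+2%:R - 1 = n.+1%:R :> R by rewrite -[n.+2%:R]natr1 addrK.
have mono (S v : R) : 1 <= S -> S <= v ->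
    S `^ (n.+2%:R / n.+1%:R) <= v `^ (n.+2%:R / n.+1%:R).
  move=> S1 Sv; have S0 : 0 <= S by exact: le_trans S1.
  by apply: ge0_ler_powR; rewrite ?nnegrE ?divr_ge0// (le_trans S0).
split.
(* Here [|x|^alpha >= 0] increases the coefficient. *)
- apply: (ereal_sup_exp_plateau (F := fun u x => (gamma + enorm x `^ alpha) *
    `|u x| `^ (n.+2%:R / n.+1%:R)) ga) => u x S S1 Su.
  apply: ler_pM; rewrite ?(ltW g0) ?powR_ge0 ?mono//.
  by rewrite lerDl powR_ge0.
(* Here it increases the power, and the base [|u x|] is at least 1 on the plateau. *)
- apply: (ereal_sup_exp_plateau (F := fun u x => gamma *
    `|u x| `^ (n.+2%:R / n.+1%:R + enorm x `^ alpha)) ga) => u x S S1 Su.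
  apply: ler_wpM2l; first exact: ltW.
  apply: le_trans (mono _ _ S1 Su) _; apply: ler_powR; first exact: le_trans S1 Su.
  by rewrite lerDl powR_ge0.
Qed.
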